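(* Consider the one-sided test of $H_0:\boldsymbol\theta\le\mathbf 0$ versus $H_1:\boldsymbol\theta\not\le\mathbf 0$ under the encompassing $g$-prior $\boldsymbol\theta\mid\sigma^2\sim N\big(\mathbf 0,g\sigma^2(\mathbf X_{\boldsymbol\theta}'\boldsymbol\Sigma^{-1}\mathbf X_{\boldsymbol\theta})^{-1}\big)$, $\pi(\boldsymbol\gamma,\sigma^2)\propto\sigma^{-2}$. The Bayes factor based on the $g$-prior with $g=g_{\max}$, where $g_{\max}=\arg\max_g\{B_{01}\}$ if $\hat{\boldsymbol\theta}\le\mathbf 0$ and $g_{\max}=\arg\max_g\{B_{10}\}$ if $\hat{\boldsymbol\theta}\not\le\mathbf 0$, is information consistent for one-sided hypothesis testing.
   Context: Model: $\mathbf y=\mathbf X_{\boldsymbol\theta}\boldsymbol\theta+\mathbf X_{\boldsymbol\gamma}\boldsymbol\gamma+\boldsymbol\epsilon$, $\boldsymbol\epsilon\sim N(\mathbf 0,\sigma^2\boldsymbol\Sigma)$, with $\mathbf y\in\mathbb R^n$, $\boldsymbol\theta\in\mathbb R^{r_1}$ ($r_1\ge1$) the tested parameters, $\boldsymbol\gamma\in\mathbb R^{r_2}$ ($r_2\ge0$) nuisance parameters, $n>r_1+r_2$, $\boldsymbol\Sigma$ a known positive definite matrix, $[\mathbf X_{\boldsymbol\theta}\ \mathbf X_{\boldsymbol\gamma}]$ of full column rank, and $\mathbf X_{\boldsymbol\theta}'\boldsymbol\Sigma^{-1}\mathbf X_{\boldsymbol\gamma}=\mathbf 0$. $\hat{\boldsymbol\theta}=(\mathbf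 X_{\boldsymbol\theta}'\boldsymbol\Sigma^{-1}\mathbf X_{\boldsymbol\theta})^{-1}\mathbf X_{\boldsymbol\theta}'\boldsymbol\Sigma^{-1}\mathbf y$ is the ML estimate and $s_{\mathbf y}^2=(\mathbf y-\mathbf X_{\boldsymbol\theta}\hat{\boldsymbol\theta}-\mathbf X_{\boldsymbol\gamma}\hat{\boldsymbol\gamma})'\boldsymbol\Sigma^{-1}(\mathbf y-\mathbf X_{\boldsymbol\theta}\hat{\boldsymbol\theta}-\mathbf X_{\boldsymbol\gamma}\hat{\boldsymbol\gamma})$. Inequalities between vectors are coordinatewise; $\boldsymbol\theta\not\le\mathbf 0$ means at least one coordinate is positive. For fixed $g>0$, under $H_t$ the prior is the encompassing prior with $\boldsymbol\theta$ truncated to $\{\boldsymbol\theta\le\mathbf 0\}$ ($t=0$) or $\{\boldsymbol\theta\not\le\mathbf 0\}$ ($t=1$) and renormalized. The Bayes factor for fixed $g$ is $$B_{10}(g)=\left(P_\pi(\boldsymbol\theta\le\mathbf 0\mid\sigma^2=1)^{-1}-1\right)^{-1}\left(P_\pi(\boldsymbol\theta\le\mathbf 0\mid\mathbf y)^{-1}-1\right),\qquad B_{01}(g)=1/B_{10}(g),$$ where the prior probability does not depend on $g$, and the posterior of $\boldsymbol\theta$ under the encompassing prior is multivariate Student $t$ with $n-r_2$ degrees of freedom, mean $\frac{g}{g+1}\hat{\boldsymbol\theta}$ and scale matrix $(n-r_2)^{-1}\big(s_{\mathbf y}^2+(g+1)^{-1}\hat{\boldsymbol\theta}'\mathbf X_{\boldsymbol\theta}'\boldsymbol\Sigma^{-1}\mathbf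 X_{\boldsymbol\theta}\hat{\boldsymbol\theta}\big)\frac{g}{g+1}(\mathbf X_{\boldsymbol\theta}'\boldsymbol\Sigma^{-1}\mathbf X_{\boldsymbol\theta})^{-1}$. The maximum over $g$ may be attained only in a limit (e.g. $g\to\infty$), so the Bayes factor at $g_{\max}$ is understood as $B_{10}=\sup_{g>0}B_{10}(g)$ if $\hat{\boldsymbol\theta}\not\le\mathbf 0$, and $B_{01}=\sup_{g>0}B_{01}(g)$, $B_{10}=1/B_{01}$, if $\hat{\boldsymbol\theta}\le\mathbf 0$. Definition: the Bayes factor for the one-sided test is information consistent if $B_{10}\to\infty$ as $|\hat{\boldsymbol\theta}|\to\infty$ with at least one coordinate of $\hat{\boldsymbol\theta}$ going to $\infty$, and $B_{10}\to0$ as all coordinates of $\hat{\boldsymbol\theta}$ go to $-\infty$. All other quantities (including $s_{\mathbf y}^2>0$) are held fixed. *)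

(* Defs.v *)
From HB Require Import structures.
From mathcomp Require Import all_boot all_order all_algebra.
From mathcomp Require Import all_classical all_reals all_analysis.

Set Implicit Arguments.
Unset Strict Implicit.
Unset Printing Implicit Defensive.

Import Order.TTheory GRing.Theory Num.Theory.
Import numFieldNormedType.Exports.

Local Open Scope classical_set_scope.
Local Open Scope ring_scope.

Lemma sigma_finite_product d1 d2 (T1 : measurableType d1)
    (T2 : measurableType d2) (R : realType)
    (m1 : {sigma_finite_measure set T1 -> \bar R})
    (m2 : {sigma_finite_measure set T2 -> \bar R}) :
  sigma_finite setT (m1 \x m2)%E.
Proof.
have /sigma_finiteP[F [TF ndF Foo]] := sigma_finiteT m1.
have /sigma_finiteP[G [TG ndG Goo]] := sigma_finiteT m2.
exists (fun k => F k `*` G k).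
  rewrite -setXTT TF TG predeqE => -[x y]; split.
    move=> [/= [i _ Fix] [j _ Gjy]]; exists (maxn i j) => //; split.
    - by move: x Fix; exact/subsetPset/ndF/leq_maxl.
    - by move: y Gjy; exact/subsetPset/ndG/leq_maxr.
  by move=> [k _ []/= ? ?]; split; exists k.
move=> k; have [? ?] := Foo k; have [? ?] := Goo k.
split; first exact: measurableX.
by rewrite product_measure1E// lte_mul_pinfty// ge0_fin_numE.
Qed.

(* Lebesgue measure on R^n, carried by n.-tuple R with its product
   sigma-algebra: the n-fold product of [lebesgue_measure]. *)
Section lebesgue_tuple.
Context (R : realType).
Local Notation mR := (measurableTypeR R).

Section cons_measure.
Context (n : nat) (mu : {sigma_finite_measure set (n.-tuple mR) -> \bar R}).

Definition tcons (p : mR * n.-tuple mR) : n.+1.-tuple mR := [tuple of p.1 :: p.2].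

Lemma measurable_tcons : measurable_fun [set: mR * n.-tuple mR] tcons.
Proof.
exact: (measurable_cons (f := fst) (g := snd) measurable_fst measurable_snd).
Qed.

HB.instance Definition _ := isMeasurableFun.Build _ _ _ _ tcons measurable_tcons.

Definition cons_measure : set (n.+1.-tuple mR) -> \bar R :=
  pushforward (lebesgue_measure \x mu)%E tcons.

Let cons_measure0 : cons_measure set0 = 0%E.
Proof. exact: measure0. Qed.

Let cons_measure_ge0 A : (0 <= cons_measure A)%E.
Proof. exact: measure_ge0. Qed.

Let cons_measure_sigma_additive : semi_sigma_additive cons_measure.
Proof. exact: measure_semi_sigma_additive. Qed.

HB.instance Definition _ := isMeasure.Build _ _ _ cons_measure
  cons_measure0 cons_measure_ge0 cons_measure_sigma_additive.

Let cons_measure_sigma_finite : sigma_finite setT cons_measure.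
Proof.
have [F UF mF] : sigma_finite setT (lebesgue_measure \x mu)%E.
  exact: sigma_finite_product.
pose tsplit (t : n.+1.-tuple mR) : mR * n.-tuple mR :=
  (thead t, [tuple of behead t]).
have mts : measurable_fun setT tsplit.
  apply/measurable_fun_pairP; split; first exact: measurable_tnth.
  exact: measurable_behead.
have tsplitK : cancel tcons tsplit.
  by case=> x t; rewrite /tsplit /tcons /= theadE; congr pair; apply/val_inj.
exists (fun k => tsplit @^-1` F k); first by rewrite -preimage_bigcup -UF.
move=> k; have [mFk Fkoo] := mF k; split.
  by rewrite -[X in measurable X]setTI; exact: mts.
rewrite /cons_measure /pushforward -comp_preimage (_ : tsplit \o tcons = id) //.
by apply/funext => p /=; rewrite tsplitK.
Qed.

HB.instance Definition _ := Measure_isSigmaFinite.Build _ _ _ cons_measure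
  cons_measure_sigma_finite.

End cons_measure.

Fixpoint lebesgue_tuple (n : nat) :
    {sigma_finite_measure set (n.-tuple mR) -> \bar R} :=
  match n with
  | 0 => \d_([tuple] : 0.-tuple mR)
  | m.+1 => cons_measure (lebesgue_tuple m)
  end.

End lebesgue_tuple.

Section vectors.
Context (R : realType).

Definition cvec n (t : n.-tuple (measurableTypeR R)) : 'cV[R]_n :=
  \col_i tnth t i.

Definition vintegral n (A : set 'cV[R]_n) (f : 'cV[R]_n -> \bar R) : \bar R :=
  (\int[@lebesgue_tuple R n]_(t in [set t | A (cvec t)]) f (cvec t))%E.

Definition quad n (A : 'M[R]_n) (v : 'cV[R]_n) : R := (v^T *m A *m v) ord0 ord0.

Definition posdef n (A : 'M[R]_n) : Prop :=
  A^T = A /\ forall v : 'cV[R]_n, v != 0 -> 0 < quad A v.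

Definition nonpos n (v : 'cV[R]_n) : bool := [forall i, v i ord0 <= 0].

Definition mvnormal_pdf n (m : 'cV[R]_n) (V : 'M[R]_n) (x : 'cV[R]_n) : R :=
  (Num.sqrt ((2 * pi) ^+ n * \det V))^-1 * expR (- quad (invmx V) (x - m) / 2).

End vectors.

Section linear_model.
Context (R : realType) (n r1 r2 : nat).
Context (Xt : 'M[R]_(n, r1)) (Xg : 'M[R]_(n, r2)) (Sigma : 'M[R]_n).

(* The blocks Xt and Xg being Sigma^-1-orthogonal, the maximum likelihood estimate
   of each coefficient vector is its own generalized least squares estimate. *)
Definition gls r (X : 'M[R]_(n, r)) (y : 'cV[R]_n) : 'cV[R]_r :=
  invmx (X^T *m invmx Sigma *m X) *m X^T *m invmx Sigma *m y.

Definition theta_hat (y : 'cV[R]_n) : 'cV[R]_r1 := gls Xt y.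

Definition gamma_hat (y : 'cV[R]_n) : 'cV[R]_r2 := gls Xg y.

Definition s2 (y : 'cV[R]_n) : R :=
  quad (invmx Sigma) (y - Xt *m theta_hat y - Xg *m gamma_hat y).

(* In the following definitions v stands for the variance parameter sigma^2. *)
Definition likelihood (y : 'cV[R]_n) (th : 'cV[R]_r1) (ga : 'cV[R]_r2)
    (v : R) : R :=
  mvnormal_pdf (Xt *m th + Xg *m ga) (v *: Sigma) y.

Definition gprior (g v : R) (th : 'cV[R]_r1) : R :=
  mvnormal_pdf 0 ((g * v) *: invmx (Xt^T *m invmx Sigma *m Xt)) th.

Definition prior_prob (g : R) (A : set 'cV[R]_r1) : \bar R :=
  vintegral A (fun th => (gprior g 1 th)%:E).

(* Likelihood times the encompassing prior gprior(th | v) * v^-1, with the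
   nuisance parameters (v, ga) integrated out; this is the posterior density of
   th up to a factor that depends on (g, y) only, so the arbitrary constant of
   the improper prior cancels in post_prob. *)
Definition post_kernel (g : R) (y : 'cV[R]_n) (th : 'cV[R]_r1) : \bar R :=
  (\int[lebesgue_measure]_(v in `]0%R, +oo[)
     vintegral setT (fun ga => (likelihood y th ga v * gprior g v th * v^-1)%:E))%E.

Definition post_prob (g : R) (y : 'cV[R]_n) (A : set 'cV[R]_r1) : \bar R :=
  (vintegral A (post_kernel g y) / vintegral setT (post_kernel g y))%E.

Definition B10_fixed (g : R) (y : 'cV[R]_n) : \bar R :=
  (((prior_prob g [set th | nonpos th])^-1 - 1)^-1 *
   ((post_prob g y [set th | nonpos th])^-1 - 1))%E.

Definition B01_fixed (g : R) (y : 'cV[R]_n) : \bar R := ((B10_fixed g y)^-1)%E.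

(* The Bayes factor at g_max: the optimum over g > 0 need not be attained, so it
   is a supremum. *)
Definition B10_gmax (y : 'cV[R]_n) : \bar R :=
  if nonpos (theta_hat y)
  then ((ereal_sup [set B01_fixed g y | g in [set g : R | 0 < g]%R])^-1)%E
  else ereal_sup [set B10_fixed g y | g in [set g : R | 0 < g]%R].

(* Limits are taken along arbitrary sequences of data sets whose estimates
   gamma_hat and s2 > 0 are held fixed while theta_hat diverges. *)
Definition information_consistent (B10 : 'cV[R]_n -> \bar R) : Prop :=
  forall (c : 'cV[R]_r2) (s : R) (y : nat -> 'cV[R]_n), 0 < s ->
    (forall k, gamma_hat (y k) = c) -> (forall k, s2 (y k) = s) ->
    ((`|theta_hat (y k)| @[k --> \oo] --> +oo ->
      (exists i, theta_hat (y k) i ord0 @[k --> \oo] --> +oo) ->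
      B10 (y k) @[k --> \oo] --> (+oo)%E) /\
     ((forall i, theta_hat (y k) i ord0 @[k --> \oo] --> -oo) ->
      B10 (y k) @[k --> \oo] --> 0%E)).

End linear_model.

(* Main.v *)
Require Import Defs.
From HB Require Import structures.
From mathcomp Require Import all_boot all_order all_algebra.
From mathcomp Require Import ring lra.
From mathcomp Require Import all_classical all_reals all_analysis.
From mathcomp Require Import measurable_realfun.

Set Implicit Arguments.
Unset Strict Implicit.
Unset Printing Implicit Defensive.

Import Order.TTheory GRing.Theory Num.Theory.
Import numFieldNormedType.Exports.

Local Open Scope classical_set_scope.
Local Open Scope ring_scope.

(** Write [Q] for the form [Xt^T Sigma^-1 Xt] and [h] for the estimate
    [theta_hat y]. The Bayes factor at [g_max] is a supremum over [g], or the
    inverse of one, so it is enough to find for each data set a single [g] for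
    which the evidence is strong. The choice is [g = 1 + quad Q h], which grows with the
    estimate.

    The posterior of [theta] given [g] is a Student distribution: a mixture over the
    variance [v] of Gaussian distributions with centre [g / (g + 1) *: h]
    ([quad_shrink], [post_kernelE]), the weight of [v] being inverse-gamma with
    scale parameter [s2 y + quad Q h / (g + 1)] ([post_scale]). For the chosen [g]
    the centre keeps at least half of each coordinate of [h], whereas the scale
    stays between [s2 y] and [s2 y + 1]. Hence the posterior mass outside a
    large ellipsoid around the centre is small uniformly in the data
    ([post_concentration]). The hypothesis that the estimate contradicts lies outside
    this ellipsoid once the relevant coordinates of [h] are large, because
    [quad Q] controls each coordinate ([coord_sqr_le_quad]). So the posterior
    odds diverge, and the prior odds stay bounded since the prior probability of
    the nonpositive orthant is bounded away from zero and one uniformly in [g]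
    ([prior_prob_nonpos_bounds]).

    The tail bound avoids the closed form of the Student density. The kernel is
    kept as an integral over [v] ([student_kernel]), so that Tonelli and the
    multivariate Gaussian integral ([vintegral_gauss]) reduce every mass to
    [variance_mass N s], the integral of an unnormalised inverse-gamma density.
    Where [quad Q] exceeds [rho], giving up half of the Gaussian exponent replaces
    the scale [s] by [s + rho / 2] ([student_kernel_tail]), and [variance_mass N s]
    vanishes as [s] grows ([variance_mass_le]); this last bound needs [2 <= N]
    with [N = n - r2], which holds because [r1 + r2 < n] and [0 < r1]. *)

(** * Quadratic forms *)

Section quadratic_forms.
Context (R : realType).

Lemma quad_sumE n (A : 'M[R]_n) v :
  quad A v = \sum_j (\sum_i v i ord0 * A i j) * v j ord0.
Proof.
rewrite /quad mxE; apply: eq_bigr => j _; rewrite mxE; congr (_ * _).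
by apply: eq_bigr => i _; rewrite mxE.
Qed.

Lemma quad0 n (A : 'M[R]_n) : quad A 0 = 0.
Proof. by rewrite /quad mulmx0 mxE. Qed.

Lemma quadZ n (A : 'M[R]_n) a v : quad A (a *: v) = a ^+ 2 * quad A v.
Proof.
by rewrite /quad [(a *: v)^T]linearZ /= -!scalemxAl -scalemxAr !mxE mulrA expr2.
Qed.

Lemma quadN n (A : 'M[R]_n) v : quad A (- v) = quad A v.
Proof. by rewrite -scaleN1r quadZ sqrrN expr1n mul1r. Qed.

Lemma quad_scale n (A : 'M[R]_n) a v : quad (a *: A) v = a * quad A v.
Proof. by rewrite /quad -scalemxAr -scalemxAl mxE. Qed.

Lemma quadD n (A : 'M[R]_n) u v : A^T = A ->
  quad A (u + v) = quad A u + quad A v + 2 * (u^T *m A *m v) ord0 ord0.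
Proof.
have addE (M N : 'M[R]_1) : (M + N) ord0 ord0 = M ord0 ord0 + N ord0 ord0.
  by rewrite mxE.
move=> As; rewrite /quad [(u + v)^T]linearD /= !mulmxDl !mulmxDr !addE.
have -> : (v^T *m A *m u) ord0 ord0 = (u^T *m A *m v) ord0 ord0.
  by rewrite -[in LHS](trmxK (v^T *m A *m u)) [LHS]mxE !trmx_mul trmxK As mulmxA.
ring.
Qed.

Lemma quad_mulmx n m (A : 'M[R]_n) (X : 'M[R]_(n, m)) z :
  quad A (X *m z) = quad (X^T *m A *m X) z.
Proof. by rewrite /quad trmx_mul !mulmxA. Qed.

Lemma posdef_quad_ge0 n (A : 'M[R]_n) v : posdef A -> 0 <= quad A v.
Proof.
move=> [_ Apos]; have [->|v0] := eqVneq v 0; first by rewrite quad0.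
exact/ltW/Apos.
Qed.

Lemma posdefZ n (A : 'M[R]_n) a : 0 < a -> posdef A -> posdef (a *: A).
Proof.
move=> a0 [As Ap]; split=> [|v v0]; first by rewrite linearZ /= As.
by rewrite quad_scale mulr_gt0 ?Ap.
Qed.

Lemma posdef_gram n m (A : 'M[R]_n) (X : 'M[R]_(n, m)) :
  posdef A -> (forall z : 'cV_m, X *m z = 0 -> z = 0) ->
  posdef (X^T *m A *m X).
Proof.
move=> [As Ap] Xinj; split=> [|z z0].
  by rewrite !trmx_mul trmxK As mulmxA.
by rewrite -quad_mulmx Ap//; apply: contraNneq z0 => /Xinj ->.
Qed.

Section schur.
Context (n : nat) (B : 'M[R]_(1 + n)).
Hypothesis Bpos : posdef B.

Let a := ulsubmx B ord0 ord0.
Let b := dlsubmx B.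

(** The Schur complement of the top left entry: the form that is left on the
    other coordinates once the square in the first one is completed. *)
Definition schur : 'M[R]_n := drsubmx B - a^-1 *: (b *m b^T).

Let urB : ursubmx B = b^T.
Proof. by rewrite /b trmx_dlsub (proj1 Bpos). Qed.

Let ulB : ulsubmx B = a%:M.
Proof. by rewrite [LHS]mx11_scalar. Qed.

Let BE : B = block_mx a%:M b^T b (drsubmx B).
Proof. by rewrite -{1}(submxK B) urB ulB. Qed.

Lemma schur_pivot_gt0 : 0 < ulsubmx B ord0 ord0.
Proof.
have v0 : col_mx 1%:M 0 != 0 :> 'cV[R]_(1 + n).
  by apply/eqP => /colP /(_ (lshift n ord0)); rewrite col_mxEu !mxE => /eqP;
     rewrite oner_eq0.
have := proj2 Bpos _ v0.
rewrite /quad {1}BE tr_col_mx mul_row_block trmx1 trmx0 !mul0mx !addr0 !mul1mx.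
by rewrite mul_row_col mulmx1 mulmx0 addr0 mxE eqxx mulr1n.
Qed.

Let a0 : 0 < a. Proof. exact: schur_pivot_gt0. Qed.

Lemma quad_schur (u : 'cV[R]_1) (x : 'cV[R]_n) :
  quad B (col_mx u x) =
  ulsubmx B ord0 ord0 *
    (u ord0 ord0 + (ulsubmx B ord0 ord0)^-1 * ((dlsubmx B)^T *m x) ord0 ord0) ^+ 2
  + quad schur x.
Proof.
rewrite -/a -/b /quad {1}BE tr_col_mx mul_row_block mul_row_col !mulmxDl.
rewrite /schur mulmxBr mulmxBl.
have -> : u = (u ord0 ord0)%:M by rewrite [LHS]mx11_scalar.
set u0 := u ord0 ord0.
rewrite -scalemxAr -scalemxAl !mulmxA tr_scalar_mx !mul_scalar_mx !mul_mx_scalar.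
have -> : x^T *m b = (b^T *m x)^T by rewrite trmx_mul trmxK.
rewrite -(mulmxA _ b^T x).
have -> : b^T *m x = ((b^T *m x) ord0 ord0)%:M by rewrite [LHS]mx11_scalar.
set w := (b^T *m x) ord0 ord0.
rewrite tr_scalar_mx !mul_scalar_mx -!scalemxAl.
rewrite -[b^T *m x]/(b^T *m x) !mxE !eqxx !mulr1n /=.
have <- : w = \sum_j b^T ord0 j * x j ord0 by rewrite /w mxE.
by field; rewrite gt_eqF.
Qed.

Lemma posdef_schur : posdef schur.
Proof.
split=> [|x x0].
  rewrite /schur linearB linearZ /= trmx_mul trmxK; congr (_ - _).
  by rewrite trmx_drsub (proj1 Bpos).
pose u : 'cV[R]_1 := (- (a^-1 * (b^T *m x) ord0 ord0))%:M.
have ux0 : col_mx u x != 0.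
  apply: contraNneq x0 => ux0; have := congr1 dsubmx ux0.
  by rewrite col_mxKd => ->; apply/eqP/colP => i; rewrite !mxE.
have := proj2 Bpos _ ux0; rewrite quad_schur -/a -/b.
by rewrite [u ord0 ord0]mxE eqxx mulr1n addNr expr0n /= mulr0 add0r.
Qed.

Lemma det_schur : \det B = ulsubmx B ord0 ord0 * \det schur.
Proof.
rewrite -/a; have -> : B = block_mx 1%:M 0 (a^-1 *: b) 1%:M *m
    block_mx a%:M b^T 0 schur.
  rewrite {1}BE mulmx_block !mul1mx !mul0mx !addr0.
  rewrite mul_mx_scalar scalerA divff ?gt_eqF// scale1r.
  by rewrite /schur -scalemxAl addrC subrK.
by rewrite det_mulmx det_lblock det_ublock !det1 !mul1r det_scalar expr1.
Qed.

End schur.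

(** The pivots of the elimination are values of the form, so their product is
    positive. *)
Lemma posdef_det_gt0 n (A : 'M[R]_n) : posdef A -> 0 < \det A.
Proof.
elim: n A => [A _|n IHn A Apos]; first by rewrite det_mx00.
by rewrite (det_schur Apos) mulr_gt0 ?schur_pivot_gt0 ?IHn//; exact: posdef_schur.
Qed.

Lemma posdef_unit n (A : 'M[R]_n) : posdef A -> A \in unitmx.
Proof. by move=> /posdef_det_gt0 A0; rewrite unitmxE unitfE gt_eqF. Qed.

Lemma posdef_invmx n (A : 'M[R]_n) : posdef A -> posdef (invmx A).
Proof.
move=> Apos; have Au := posdef_unit Apos.
have iAs : (invmx A)^T = invmx A by rewrite trmx_inv (proj1 Apos).
split=> // v v0.
have -> : quad (invmx A) v = quad A (invmx A *m v).
  by rewrite quad_mulmx iAs mulVmx// mul1mx.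
apply: (proj2 Apos); apply: contraNneq v0 => /(congr1 (mulmx A)).
by rewrite mulKVmx// mulmx0 => ->.
Qed.

Lemma posdef_diag_gt0 n (A : 'M[R]_n) (i : 'I_n) : posdef A -> 0 < A i i.
Proof.
move=> [_ Ap]; have e0 : delta_mx i ord0 != 0 :> 'cV[R]_n.
  by apply/eqP => /colP /(_ i) /eqP; rewrite !mxE !eqxx oner_eq0.
have := Ap _ e0.
by rewrite /quad trmx_delta -rowE -colE !mxE.
Qed.

(** Among the vectors with a prescribed [i]-th coordinate, the form is smallest at a
    multiple of the [i]-th column of [invmx A], where the bound is an equality. *)
Lemma coord_sqr_le_quad n (A : 'M[R]_n) (i : 'I_n) (v : 'cV[R]_n) : posdef A ->
  v i ord0 ^+ 2 <= invmx A i i * quad A v.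
Proof.
move=> Apos; have Au := posdef_unit Apos.
have q0 := posdef_diag_gt0 i (posdef_invmx Apos).
pose e : 'cV[R]_n := delta_mx i ord0.
have eE m (M : 'M[R]_(n, m)) j : (e^T *m M) ord0 j = M i j.
  by rewrite /e trmx_delta -rowE mxE.
have qE : quad (invmx A) e = invmx A i i.
  by rewrite /quad /e -mulmxA -colE eE mxE.
pose a := - (v i ord0 / invmx A i i).
have := posdef_quad_ge0 (v + a *: (invmx A *m e)) Apos.
rewrite quadD ?(proj1 Apos)// quadZ quad_mulmx (proj1 (posdef_invmx Apos)).
rewrite mulVmx// mul1mx qE.
have -> : (v^T *m A *m (a *: (invmx A *m e))) ord0 ord0 = a * v i ord0.
  rewrite -scalemxAr mxE mulmxA mulmxK//; congr (_ * _).
  by rewrite /e -colE !mxE.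
rewrite /a; set q := invmx A i i in q0 *; set w := v i ord0.
have -> : quad A v + (- (w / q)) ^+ 2 * q + 2 * (- (w / q) * w) =
  quad A v - w ^+ 2 / q by field; rewrite gt_eqF.
by rewrite subr_ge0 ler_pdivrMr// mulrC.
Qed.

Lemma quad_box_le n (A : 'M[R]_n) (v : 'cV[R]_n) c : (forall i, `|v i ord0| <= c) ->
  quad A v <= c ^+ 2 * \sum_j \sum_i `|A i j|.
Proof.
move=> vc; rewrite quad_sumE mulr_sumr ler_sum// => j _.
rewrite mulr_suml mulr_sumr ler_sum// => i _.
rewrite (le_trans (ler_norm _))// !normrM mulrAC expr2 ler_wpM2r//.
by rewrite ler_pM.
Qed.

End quadratic_forms.

(** * The multivariate Gaussian integral *)

Section gaussian_integral.
Context (R : realType).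
Local Notation mR := (measurableTypeR R).
Local Notation leb := (@lebesgue_measure R).

Lemma measurable_quad n (A : 'M[R]_n) (m : 'cV[R]_n) :
  measurable_fun [set: n.-tuple mR] (fun t => quad A (cvec t - m)).
Proof.
rewrite (_ : (fun _ => _) = (fun t : n.-tuple mR =>
  \sum_j (\sum_i (tnth t i - m i ord0) * A i j) * (tnth t j - m j ord0))).
  apply: measurable_sum => j; apply: measurable_funM.
    apply: measurable_sum => i; apply: measurable_funM => //.
    by apply: measurable_funB => //; exact: measurable_tnth.
  by apply: measurable_funB => //; exact: measurable_tnth.
apply/funext => t; rewrite quad_sumE; apply: eq_bigr => j _; rewrite !mxE.
by congr (_ * _); apply: eq_bigr => i _; rewrite !mxE.
Qed.

Lemma integral_gauss1 (a c : R) : 0 < a ->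
  (\int[leb]_x (expR (- (a * (x - c) ^+ 2) / 2))%:E = (Num.sqrt (2 * pi / a))%:E)%E.
Proof.
move=> a0; pose s := (Num.sqrt a)^-1.
have sa : s ^+ 2 = a^-1 by rewrite /s exprVn sqr_sqrtr// ltW.
have s0 : s != 0 by rewrite /s invr_eq0 gt_eqF// sqrtr_gt0.
have := @integral_normal_pdf R c s; rewrite normal_pdfE//.
have -> : Num.sqrt (2 * pi / a) = (normal_peak s)^-1.
  by rewrite /normal_peak invrK sa; congr Num.sqrt; rewrite -mulr_natr; ring.
have p0 := normal_peak_gt0 s0.
under eq_integral do rewrite EFinM.
rewrite ge0_integralZl_EFin//; last 3 first.
- by move=> x _; rewrite lee_fin expR_ge0.
- by apply/measurable_EFinP; exact: measurable_normal_fun.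
- exact: ltW.
move=> /(congr1 (fun z => ((normal_peak s)^-1)%:E * z)%E).
rewrite muleA -EFinM mulVf ?gt_eqF// mul1e mule1 => <-.
apply: eq_integral => x _; congr (expR _)%:E.
by rewrite sa -mulr_natr; field; rewrite gt_eqF.
Qed.

(** The first coordinate is integrated innermost, where the other ones only
    shift the mean of a one-dimensional Gaussian. *)
Lemma integral_lebesgue_tupleS n (f : n.+1.-tuple mR -> \bar R) :
  measurable_fun setT f -> (forall t, 0 <= f t)%E ->
  (\int[@lebesgue_tuple R n.+1]_t f t =
   \int[@lebesgue_tuple R n]_t \int[leb]_x f (tcons (x, t)))%E.
Proof.
move=> mf f0; rewrite (ge0_integral_pushforward (@measurable_tcons R n))//=.
rewrite preimage_setT (fubini_tonelli2 (f \o @tcons R n))//=.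
by apply: measurableT_comp => //; exact: measurable_tcons.
Qed.

Lemma cvec_tcons n x (t : n.-tuple mR) :
  cvec (tcons (x, t)) = col_mx (x%:M : 'cV[R]_1) (cvec t).
Proof.
apply/colP => /= i; rewrite mxE -(@fintype.splitK 1 n i).
case: (@fintype.split 1 n i) => j /=.
  have := @col_mxEu R 1 n 1 (x%:M) (cvec t) j ord0.
  by rewrite [X in _ = X -> _]mxE ord1 eqxx mulr1n => ->; rewrite (tnth_nth x).
have := @col_mxEd R 1 n 1 (x%:M) (cvec t) j ord0.
by rewrite [X in _ = X -> _]mxE => ->; rewrite !(tnth_nth x).
Qed.

Lemma vintegralT n (f : 'cV[R]_n -> \bar R) :
  (vintegral setT f = \int[@lebesgue_tuple R n]_t f (cvec t))%E.
Proof. by []. Qed.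

Lemma measurable_gauss n (B : 'M[R]_n) (m : 'cV[R]_n) :
  measurable_fun [set: n.-tuple mR]
    (fun t => (expR (- quad B (cvec t - m) / 2))%:E).
Proof.
apply/measurable_EFinP; apply: measurableT_comp => //.
apply: measurable_funM => //; apply: measurableT_comp => //.
exact: measurable_quad.
Qed.

(** Completing the square in the first coordinate leaves a one-dimensional
    Gaussian integral whose value depends on the pivot only, times the same
    integral for the Schur complement; the pivots multiply to the determinant. *)
Lemma vintegral_gauss n (B : 'M[R]_n) (m : 'cV[R]_n) : posdef B ->
  vintegral setT (fun x => (expR (- quad B (x - m) / 2))%:E) =
  (Num.sqrt ((2 * pi) ^+ n / \det B))%:E.
Proof.
rewrite vintegralT; elim: n B m => [|n IHn] B m Bpos.
  rewrite [LHS]integral_dirac//; last exact: measurable_gauss.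
  rewrite diracT mul1e quad_sumE big_ord0 oppr0 mul0r expR0.
  by rewrite det_mx00 expr0 divr1 sqrtr1.
rewrite integral_lebesgue_tupleS; last 2 first.
- exact: measurable_gauss.
- by move=> t; rewrite lee_fin expR_ge0.
(* The dimensions of the blocks are given explicitly because [n.+1] only
   converts to [1 + n]. *)
set a := (@ulsubmx R 1 n 1 n B) ord0 ord0.
have a0 : 0 < a by exact: (@schur_pivot_gt0 R n B Bpos).
pose u : 'cV[R]_1 := @usubmx R 1 n 1 m.
pose l : 'cV[R]_n := @dsubmx R 1 n 1 m.
have mE : m = col_mx u l by rewrite vsubmxK.
have key t x : quad B (cvec (tcons (x, t)) - m) =
    a * (x - (u ord0 ord0 - a^-1 * ((@dlsubmx R 1 n 1 n B)^T *m (cvec t - l)) ord0 ord0)) ^+ 2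
    + quad (@schur R n B) (cvec t - l).
  have -> : cvec (tcons (x, t)) - m =
      (col_mx (x%:M - u) (cvec t - l) : 'cV[R]_(1 + n)).
    rewrite mE cvec_tcons.
    have := @add_col_mx R 1 n 1 (x%:M) (cvec t) (- u) (- l).
    by rewrite -(@opp_col_mx R 1 n 1 u l).
  rewrite (quad_schur Bpos) -/a.
  congr (_ * _ ^+ 2 + _).
  by set w := (_ *m _) _ _; rewrite !mxE eqxx mulr1n; ring.
under eq_integral => t _.
  under eq_integral => x _ do rewrite key opprD mulrDl addrC expRD EFinM.
  rewrite ge0_integralZl_EFin ?expR_ge0//; last first.
    apply/measurable_EFinP; apply: measurableT_comp => //.
    apply: measurable_funM => //; apply: measurableT_comp => //.
    apply: measurable_funM => //; apply: measurable_funX.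
    exact: measurable_funB.
  rewrite integral_gauss1// muleC.
  over.
rewrite ge0_integralZl_EFin ?sqrtr_ge0//; last exact: measurable_gauss.
rewrite IHn; last exact: posdef_schur.
rewrite -EFinM -sqrtrM; last by rewrite divr_ge0 ?mulr_ge0 ?pi_ge0// ltW.
congr (Num.sqrt _)%:E; rewrite (@det_schur R n B Bpos) -/a exprS.
by rewrite mulrACA -invfM.
Qed.

End gaussian_integral.

(** * The inverse-gamma integral over the variance *)

Lemma ge0_integral_ge_cst d (T : measurableType d) (R : realType)
    (mu : {measure set T -> \bar R}) (D B : set T) (f : T -> \bar R) (c : R) :
  measurable D -> measurable B -> 0 <= c -> measurable_fun D f ->
  (forall x, D x -> 0 <= f x)%E -> B `<=` D ->
  (forall x, B x -> c%:E <= f x)%E ->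
  (c%:E * mu B <= \int[mu]_(x in D) f x)%E.
Proof.
move=> mD mB c0 mf f0 BD cf; rewrite -integral_cst//.
apply: (@le_trans _ _ (\int[mu]_(x in B) f x)%E).
  apply: ge0_le_integral => //.
  by move: mf; exact: measurable_funS.
exact: ge0_subset_integral.
Qed.

Section variance_integral.
Context (R : realType).
Local Notation leb := (@lebesgue_measure R).

(** The [j.+1]-th root of the exponential dominates [1 + x] up to a constant;
    raising to the power [j] still leaves room. *)
Lemma expR_dominates_power (j : nat) (d : R) : 0 < d ->
  exists C : R, forall x, 0 <= x -> (1 + x) ^+ j * expR (- (d * x)) <= C.
Proof.
move=> d0; pose e := d / j.+1%:R.
have e0 : 0 < e by rewrite divr_gt0.
exists ((1 + e^-1) ^+ j) => x x0.
have ex0 : 0 <= e * x by rewrite mulr_ge0// ltW.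
have h1 : 1 + x <= (1 + e^-1) * expR (e * x).
  rewrite (@le_trans _ _ ((1 + e^-1) * (1 + e * x)))//.
    have -> : (1 + e^-1) * (1 + e * x) = 1 + x + (e * x + e^-1).
      by field; rewrite gt_eqF.
    by rewrite lerDl addr_ge0// invr_ge0 ltW.
  by rewrite ler_wpM2l ?expR_ge1Dx// addr_ge0// invr_ge0 ltW.
have h2 : (1 + x) ^+ j <= (1 + e^-1) ^+ j * expR (d * x).
  rewrite (@le_trans _ _ (((1 + e^-1) * expR (e * x)) ^+ j))//.
    by rewrite lerXn2r// nnegrE ?addr_ge0// mulr_ge0 ?expR_ge0// addr_ge0// invr_ge0 ltW.
  rewrite exprMn ler_wpM2l ?exprn_ge0 ?addr_ge0 ?invr_ge0 ?(ltW e0)//.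
  rewrite -expRM_natl ler_expR /e mulrA ler_wpM2r// mulrCA ler_piMr ?(ltW d0)//.
  by rewrite ler_pdivrMr// mul1r ler_nat.
by rewrite expRN ler_pdivrMr ?expR_gt0.
Qed.

Lemma integral_shifted_inverse_square (d : R) : 0 < d ->
  (\int[leb]_(v in `[0%R, +oo[) ((v + d) ^- 2)%:E = (d^-1)%:E)%E.
Proof.
move=> d0.
pose F : R -> R := - (fun v : R => (v + d)^-1).
have dFx (x : R) : 0 <= x -> is_derive x 1 F ((x + d) ^- 2).
  move=> x0; have xd : x + d != 0 by rewrite gt_eqF// ltr_wpDl.
  have dV : is_derive x 1 (fun v : R => (v + d)^-1) (- (x + d) ^- 2 *: (1 + 0)).
    exact: is_deriveV.
  have := is_deriveN dV.
  by rewrite addr0 /GRing.scale/= mulr1 opprK.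
have -> : ((d^-1)%:E = 0%:E - (F 0)%:E)%E.
  by rewrite /F fctE !add0r -EFinN opprK.
apply: (@ge0_continuous_FTC2y R (fun v => (v + d) ^- 2) F).
- by move=> x x0; rewrite invr_ge0 exprn_ge0// addr_ge0// ltW.
- apply: continuous_in_subspaceT => x; rewrite inE/= in_itv/= andbT => x0.
  apply: cvgV; first by rewrite expf_neq0// gt_eqF// ltr_wpDl.
  have cD : (v + d @[v --> x] --> x + d).
    by apply: cvgD; [exact: cvg_id|exact: cvg_cst].
  exact: (cvgM cD cD).
- rewrite -oppr0; apply: cvgN; apply/gtr0_cvgV0.
    by near=> x; rewrite ltr_wpDl.
  exact: cvg_addrr.
- by move=> x x0; apply: ex_derive; exact/dFx/ltW.
- apply: cvg_at_right_filter; apply: differentiable_continuous.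
  by apply/derivable1_diffP; apply: ex_derive; exact/dFx.
- move=> x; rewrite in_itv/= andbT => x0.
  by rewrite derive1E; apply: derive_val; exact/dFx/ltW.
Unshelve. all: by end_near. Qed.

(** Up to its normalising constant, the inverse-gamma density of shape [N / 2]
    and scale [s / 2] at the variance [v]. *)
Lemma measurable_invr : measurable_fun [set: R] (fun x : R => x^-1).
Proof.
rewrite -(setUv [set 0]); apply/measurable_funU => //.
  exact: measurableC.
split; first exact: measurable_fun_set1.
apply: open_continuous_measurable_fun; first exact/closed_openC/closed_eq.
by move=> x; rewrite inE/= => /eqP; exact: inv_continuous.
Qed.

Definition variance_kernel (N : nat) (s v : R) : R :=
  (Num.sqrt v ^+ N)^-1 * v^-1 * expR (- (s / v) / 2).

Lemma variance_kernel_ge0 N s v : 0 <= v -> 0 <= variance_kernel N s v.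
Proof.
by move=> v0; rewrite /variance_kernel !mulr_ge0 ?invr_ge0 ?exprn_ge0 ?expR_ge0.
Qed.

Lemma measurable_variance_kernel N s (D : set R) :
  measurable_fun D (variance_kernel N s).
Proof.
apply: measurable_funTS; apply: measurable_funM.
  apply: measurable_funM; last exact: measurable_invr.
  apply: (measurableT_comp (measurable_invr)).
  by apply: measurable_funX; apply: continuous_measurable_fun; exact: sqrt_continuous.
apply: measurableT_comp => //.
apply: measurable_funM => //; apply: measurableT_comp => //.
by apply: measurable_funM => //; exact: measurable_invr.
Qed.

Definition variance_mass N s : \bar R :=
  (\int[leb]_(v in `]0%R, +oo[) (variance_kernel N s v)%:E)%E.

Lemma variance_mass_gt0 N s : (0 < variance_mass N s)%E.
Proof.
pose c := (Num.sqrt 2 ^+ N)^-1 * 2^-1 * expR (- `|s| / 2) : R.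
have c0 : 0 < c by rewrite !mulr_gt0 ?invr_gt0 ?exprn_gt0 ?sqrtr_gt0 ?expR_gt0.
have I0 : (0 < c%:E * leb `[1%R, 2%R]%classic)%E.
  rewrite lebesgue_measure_itv/= lte_fin ltr1n -EFinB -EFinM lte_fin.
  by rewrite mulr_gt0// subr_gt0 ltr1n.
apply: (lt_le_trans I0); apply: ge0_integral_ge_cst => //.
- exact: ltW.
- by apply/measurable_EFinP; exact: measurable_variance_kernel.
- by move=> v; rewrite /= in_itv/= andbT lee_fin => /ltW; exact: variance_kernel_ge0.
- by move=> v; rewrite /= !in_itv/= andbT => /andP[v1 _]; rewrite (lt_le_trans _ v1).
- move=> v; rewrite /= in_itv/= => /andP[v1 v2].
  have v0 : 0 < v by rewrite (lt_le_trans _ v1).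
  rewrite lee_fin /variance_kernel ler_pM ?mulr_ge0 ?invr_ge0 ?exprn_ge0 ?expR_ge0//.
    rewrite ler_pM ?invr_ge0 ?exprn_ge0//.
      rewrite lef_pV2 ?posrE ?exprn_gt0 ?sqrtr_gt0//.
      by rewrite lerXn2r ?nnegrE ?sqrtr_ge0// ler_sqrt.
    by rewrite lef_pV2 ?posrE.
  rewrite ler_expR ler_wpM2r// lerN2.
  rewrite (le_trans (ler_norm _))// normrM ler_piMr// normfV invf_le1 ?normr_gt0 ?gt_eqF//.
  by rewrite (le_trans v1)// ler_norm.
Qed.

(** Half of the exponent absorbs the factor [v ^- (N / 2 - 1)], which is where
    [2 <= N] enters; the other half dominates [(1 + s / (8 v)) ^ 2], turning
    [v ^- 2] into an integrable square that records [s]. *)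
Lemma variance_kernel_le N s0 : (2 <= N)%N -> 0 < s0 ->
  exists C : R, 0 <= C /\ forall s v, s0 <= s -> 0 < v ->
    variance_kernel N s v <= C * (v + s / 8) ^- 2.
Proof.
move=> N2 s00.
have s40 : 0 < s0 / 4 by rewrite divr_gt0.
have [C HC] := expR_dominates_power (N - 2) s40.
exists C; split.
  by rewrite (le_trans _ (HC 0 _))// addr0 expr1n mul1r expR_ge0.
move=> s v ss v0; have s_gt0 : 0 < s by rewrite (lt_le_trans s00).
have vn0 : v != 0 by rewrite gt_eqF.
have sv0 : 0 < Num.sqrt v by rewrite sqrtr_gt0.
have -> : variance_kernel N s v =
    ((Num.sqrt v)^-1 ^+ (N - 2) * expR (- (s / v) / 4)) *
    (v ^- 2 * expR (- (s / v) / 4)).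
  rewrite mulrACA -expRD; congr (_ * expR _); last by field.
  rewrite -[in LHS](subnK N2) exprD sqr_sqrtr ?ltW// !invfM -exprVn.
  by rewrite -mulrA -expr2 exprVn.
apply: ler_pM.
- by rewrite mulr_ge0 ?expR_ge0// exprn_ge0// invr_ge0 ltW.
- by rewrite mulr_ge0 ?expR_ge0// invr_ge0 exprn_ge0// ltW.
- apply: le_trans (HC v^-1 _); last by rewrite invr_ge0 ltW.
  apply: ler_pM; rewrite ?expR_ge0 ?exprn_ge0 ?invr_ge0 ?(ltW sv0)//.
    rewrite lerXn2r ?nnegrE ?addr_ge0 ?invr_ge0 ?(ltW sv0) ?(ltW v0)//.
    (* With y = sqrt v ^-1 this is y <= 1 + y ^ 2. *)
    have -> : v^-1 = (Num.sqrt v)^-1 ^+ 2 by rewrite exprVn sqr_sqrtr ?ltW.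
    set y := (Num.sqrt v)^-1.
    have : 0 <= (y - 1/2) ^+ 2 by rewrite sqr_ge0.
    by nra.
  rewrite ler_expR !mulNr lerN2 [leRHS]mulrAC.
  by rewrite ler_wpM2r// ?invr_ge0 ?(ltW v0)// ler_wpM2r.
- rewrite mulNr expRN.
  have e0 : 0 < 1 + s / v / 8 by rewrite addr_gt0 ?divr_gt0.
  have h : (1 + s / v / 8) ^+ 2 <= expR (s / v / 4).
    have -> : s / v / 4 = 2%:R * (s / v / 8) by field.
    rewrite expRM_natl lerXn2r ?nnegrE ?expR_ge0 ?(ltW e0)//.
    exact: expR_ge1Dx.
  have -> : (v + s / 8) ^+ 2 = v ^+ 2 * (1 + s / v / 8) ^+ 2 by field.
  rewrite (invfM (v ^+ 2)) ler_wpM2l// ?invr_ge0 ?exprn_ge0 ?(ltW v0)//.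
  by rewrite lef_pV2 ?posrE ?expR_gt0 ?exprn_gt0.
Qed.

(** The exact order is [s ^- (N / 2)], but any bound that vanishes for large [s]
    makes the posterior tails negligible. *)
Lemma variance_mass_le N s0 : (2 <= N)%N -> 0 < s0 ->
  exists C : R, forall s, s0 <= s -> (variance_mass N s <= (C / s)%:E)%E.
Proof.
move=> N2 s00; have [C [C0 HC]] := variance_kernel_le N2 s00.
exists (C * 8) => s ss; have s_gt0 : 0 < s by rewrite (lt_le_trans s00).
have s80 : 0 < s / 8 by rewrite divr_gt0.
have mf : measurable_fun [set: R] (fun v : R => ((v + s / 8) ^- 2)%:E).
  apply/measurable_EFinP; apply: (measurableT_comp measurable_invr).
  by apply: measurable_funX; exact: measurable_funD.
apply: (@le_trans _ _ (\int[leb]_(v in `[0%R, +oo[) (C%:E * ((v + s / 8) ^- 2)%:E))%E).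
  apply: (@le_trans _ _ (\int[leb]_(v in `]0%R, +oo[) (C%:E * ((v + s / 8) ^- 2)%:E))%E).
    apply: ge0_le_integral => //.
    - by move=> v; rewrite /= in_itv/= andbT lee_fin => /ltW; exact: variance_kernel_ge0.
    - by apply/measurable_EFinP; exact: measurable_variance_kernel.
    - by apply: measurable_funTS; apply: measurable_funeM.
    - by move=> v; rewrite /= in_itv/= andbT => v0; rewrite -EFinM lee_fin HC.
  apply: ge0_subset_integral => //.
  - by apply: measurable_funTS; apply: measurable_funeM.
  - move=> v; rewrite /= in_itv/= andbT => v0.
    by rewrite -EFinM lee_fin mulr_ge0// invr_ge0 sqr_ge0.
  - by move=> v; rewrite /= !in_itv/= !andbT => /ltW.
rewrite ge0_integralZl_EFin//; last 2 first.
- by move=> v _; rewrite lee_fin invr_ge0 sqr_ge0.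
- exact: measurable_funTS.
rewrite integral_shifted_inverse_square// -EFinM lee_fin invf_div mulrA//.
Qed.
Lemma variance_mass_nonincreasing N (s t : R) : s <= t ->
  (variance_mass N t <= variance_mass N s)%E.
Proof.
move=> st; apply: ge0_le_integral => //.
- by move=> v; rewrite /= in_itv/= andbT lee_fin => /ltW; exact: variance_kernel_ge0.
- by apply/measurable_EFinP; exact: measurable_variance_kernel.
- by apply/measurable_EFinP; exact: measurable_variance_kernel.
move=> v; rewrite /= in_itv/= andbT lee_fin => v0; apply: ler_wpM2l.
  by rewrite mulr_ge0 ?invr_ge0 ?exprn_ge0 ?sqrtr_ge0 ?(ltW v0).
by rewrite ler_expR ler_wpM2r// lerN2 ler_wpM2r// invr_ge0 ltW.
Qed.

End variance_integral.

(** * Tonelli on rectangles and rescaled Gaussian integrals *)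

Section tonelli_on_rectangles.
Context d1 d2 (T1 : measurableType d1) (T2 : measurableType d2) (R : realType).
Context (m1 : {sigma_finite_measure set T1 -> \bar R}).
Context (m2 : {sigma_finite_measure set T2 -> \bar R}).
Context (A : set T1) (D : set T2) (f : T1 * T2 -> \bar R).
Hypotheses (mA : measurable A) (mD : measurable D).
Hypothesis mf : measurable_fun [set: T1 * T2] f.
Hypothesis f0 : forall x y, D y -> (0 <= f (x, y))%E.

Let h := f \_ (A `*` D).

Let mh : measurable_fun setT h.
Proof.
apply/(measurable_restrictT _ (measurableX mA mD)).
exact: measurable_funTS.
Qed.

Let h0 p : (0 <= h p)%E.
Proof. by apply: erestrict_ge0 => -[x y] [_ Dy]; exact: f0. Qed.

Lemma tonelli_rectangle :
  (\int[m1]_(x in A) \int[m2]_(y in D) f (x, y) =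
   \int[m2]_(y in D) \int[m1]_(x in A) f (x, y))%E.
Proof.
rewrite [LHS]integral_mkcond [RHS]integral_mkcond.
have /= := fubini_tonelli (m1 := m1) (m2 := m2) h mh h0.
congr (_ = _).
  apply: eq_integral => x _; rewrite patchE.
  case: ifPn => xA.
    rewrite [RHS]integral_mkcond; apply: eq_integral => y _.
    by rewrite /h !patchE in_setX xA.
  apply: integral0_eq => y _.
  by rewrite /h !patchE in_setX (negPf xA).
apply: eq_integral => y _; rewrite patchE.
case: ifPn => yD.
  rewrite [RHS]integral_mkcond; apply: eq_integral => x _.
  by rewrite /h !patchE in_setX yD andbT.
apply: integral0_eq => x _.
by rewrite /h !patchE in_setX (negPf yD) andbF.
Qed.

Lemma measurable_tonelli_rectangle :
  measurable_fun A (fun x => \int[m2]_(y in D) f (x, y))%E.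
Proof.
have mF := measurable_fun_fubini_tonelli_F (m2 := m2) h mh h0.
apply: (eq_measurable_fun (fubini_F m2 h)); last exact: measurable_funTS.
move=> x xA; rewrite /fubini_F [RHS]integral_mkcond.
by apply: eq_integral => y _; rewrite /h !patchE in_setX xA.
Qed.

End tonelli_on_rectangles.

Section scaling.
Context (R : realType).

Lemma sqrt_exprn (x : R) k : 0 <= x -> Num.sqrt (x ^+ k) = Num.sqrt x ^+ k.
Proof.
move=> x0; elim: k => [|k IHk]; first by rewrite !expr0 sqrtr1.
by rewrite !exprS sqrtrM// IHk.
Qed.

(** The integral of the Gaussian kernel of precision [k *: Q]; dividing the
    precision by [v] multiplies it by [sqrt v ^+ r]. *)
Definition gauss_mass r (Q : 'M[R]_r) (k : R) : R :=
  Num.sqrt ((2 * pi) ^+ r / (k ^+ r * \det Q)).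

Lemma gauss_mass_gt0 r (Q : 'M[R]_r) k : posdef Q -> 0 < k -> 0 < gauss_mass Q k.
Proof.
move=> Qp k0; rewrite sqrtr_gt0 divr_gt0 ?mulr_gt0 ?exprn_gt0 ?posdef_det_gt0//.
by rewrite mulr_gt0// pi_gt0.
Qed.

Lemma vintegral_gauss_scaled r (Q : 'M[R]_r) (m : 'cV[R]_r) (k v : R) :
  posdef Q -> 0 < k -> 0 < v ->
  vintegral setT (fun x => (expR (- (k / v * quad Q (x - m)) / 2))%:E) =
  (gauss_mass Q k * Num.sqrt v ^+ r)%:E.
Proof.
move=> Qp k0 v0.
under [X in vintegral _ X]funext => x do rewrite -quad_scale.
rewrite vintegral_gauss; last by apply: posdefZ => //; exact: divr_gt0.
congr EFin; rewrite -sqrt_exprn ?(ltW v0)// -sqrtrM; last first.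
  by rewrite divr_ge0 ?mulr_ge0 ?exprn_ge0 ?mulr_ge0 ?pi_ge0 ?(ltW k0)// ltW// posdef_det_gt0.
congr Num.sqrt; rewrite detZ !exprMn exprVn.
by field; rewrite !expf_neq0 ?gt_eqF// posdef_det_gt0.
Qed.

Lemma gauss_mass_half r (Q : 'M[R]_r) k : posdef Q -> 0 < k ->
  gauss_mass Q (k / 2) = Num.sqrt 2 ^+ r * gauss_mass Q k.
Proof.
move=> Qp k0; rewrite -sqrt_exprn// -sqrtrM ?exprn_ge0//.
congr Num.sqrt; rewrite !exprMn exprVn.
by field; rewrite !expf_neq0 ?gt_eqF// posdef_det_gt0.
Qed.

End scaling.

(** * The Gaussian densities of the model *)

Section density.
Context (R : realType).

Lemma full_col_rank_inj n r (X : 'M[R]_(n, r)) : \rank X = r ->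
  forall z : 'cV_r, X *m z = 0 -> z = 0.
Proof.
move=> rX z Xz0; have XTfree : row_free X^T by rewrite /row_free mxrank_tr rX.
have : z^T *m X^T = 0 by rewrite -trmx_mul Xz0 trmx0.
rewrite -(mul0mx _ X^T) => /(row_free_inj XTfree) /(congr1 trmx).
by rewrite trmxK trmx0.
Qed.

Lemma mvnormal_pdf_scaled r (V : 'M[R]_r) (m x : 'cV[R]_r) v :
  posdef V -> 0 < v ->
  mvnormal_pdf m (v *: V) x =
  (Num.sqrt ((2 * pi) ^+ r * \det V) * Num.sqrt v ^+ r)^-1 *
    expR (- (v^-1 * quad (invmx V) (x - m)) / 2).
Proof.
move=> Vp v0; rewrite /mvnormal_pdf invmxZ; last first.
  by rewrite posdef_unit//; exact: posdefZ.
rewrite quad_scale detZ -sqrt_exprn ?(ltW v0)// -sqrtrM; last first.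
  by rewrite mulr_ge0 ?exprn_ge0 ?mulr_ge0 ?pi_ge0// ltW// posdef_det_gt0.
by congr ((Num.sqrt _)^-1 * _); ring.
Qed.

(** The prior is centred at the origin and the likelihood at the estimate, both
    in the metric of the same form, so the exponents combine by completing the
    square around a shrunken estimate. *)
Lemma quad_shrink r (Q : 'M[R]_r) (x h : 'cV[R]_r) g : Q^T = Q -> 0 < g ->
  quad Q (x - h) + g^-1 * quad Q x =
  (g + 1) / g * quad Q (x - (g / (g + 1)) *: h) + (g + 1)^-1 * quad Q h.
Proof.
move=> Qs g0; have g1 : 0 < g + 1 by rewrite addr_gt0.
have E c : quad Q (x - c *: h) =
    quad Q x + c ^+ 2 * quad Q h - 2 * c * (x^T *m Q *m h) ord0 ord0.
  rewrite quadD// quadN quadZ.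
  have -> : (x^T *m Q *m - (c *: h)) ord0 ord0 = - c * (x^T *m Q *m h) ord0 ord0.
    by rewrite -scaleNr -scalemxAr mxE.
  by ring.
rewrite E -{1}(scale1r h) E.
by field; rewrite !gt_eqF.
Qed.

End density.

(** * Scale mixtures of Gaussian kernels *)

Section student_kernel.
Context (R : realType) (r N : nat) (Q : 'M[R]_r) (m : 'cV[R]_r).
Hypothesis Q_posdef : posdef Q.
Local Notation mR := (measurableTypeR R).
Local Notation leb := (@lebesgue_measure R).

Let integrand (c s k : R) (th : 'cV[R]_r) (v : R) : R :=
  c * variance_kernel (N + r) s v * expR (- (k / v * quad Q (th - m)) / 2).

(** An unnormalised multivariate Student density, kept as the mixture over the
    variance [v] that defines it: Tonelli then reduces its masses to Gaussian
    integrals and to [variance_mass]. *)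
Definition student_kernel (c s k : R) (th : 'cV[R]_r) : \bar R :=
  (\int[leb]_(v in `]0%R, +oo[)
     (c * variance_kernel (N + r) s v *
      expR (- (k / v * quad Q (th - m)) / 2))%:E)%E.

Let measurable_integrand c s k :
  measurable_fun [set: r.-tuple mR * R] (fun p => (integrand c s k (cvec p.1) p.2)%:E).
Proof.
apply/measurable_EFinP; apply: measurable_funM.
  apply: measurable_funM => //.
  by apply: measurableT_comp => //; exact: measurable_variance_kernel.
apply: measurableT_comp => //; apply: measurable_funM => //.
apply: measurableT_comp => //; apply: measurable_funM.
  apply: measurable_funM => //.
  by apply: measurableT_comp => //; exact: measurable_invr.
by apply: (measurableT_comp (measurable_quad Q m)).
Qed.

Let integrand_ge0 c s k th v : 0 <= c -> v \in `]0%R, +oo[ ->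
  (0 <= (integrand c s k th v)%:E)%E.
Proof.
rewrite in_itv/= andbT => c0 v0; rewrite lee_fin.
apply: mulr_ge0; last exact: expR_ge0.
by apply: mulr_ge0 => //; exact/variance_kernel_ge0/ltW.
Qed.

Lemma measurable_student_kernel c s k : 0 <= c ->
  measurable_fun [set: r.-tuple mR] (fun t => student_kernel c s k (cvec t)).
Proof.
move=> c0; apply: (measurable_tonelli_rectangle leb measurableT
  (measurable_itv `]0%R, +oo[) (measurable_integrand c s k)).
by move=> t v v0; exact: integrand_ge0.
Qed.

Lemma student_kernel_ge0 c s k th : 0 <= c -> (0 <= student_kernel c s k th)%E.
Proof. by move=> c0; apply: integral_ge0 => v v0; exact: integrand_ge0. Qed.

(** The factor [sqrt v ^+ r] of the Gaussian integral lowers the degree of the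
    inverse-gamma weight from [N + r] to [N]. *)
Lemma student_total_mass c s k : 0 <= c -> 0 < k ->
  vintegral setT (student_kernel c s k) =
  ((c * gauss_mass Q k)%:E * variance_mass N s)%E.
Proof.
move=> c0 k0; rewrite vintegralT.
rewrite (tonelli_rectangle (@lebesgue_tuple R r) leb measurableT
  (measurable_itv `]0%R, +oo[) (measurable_integrand c s k)); last first.
  by move=> t v v0; exact: integrand_ge0.
rewrite -ge0_integralZl_EFin//; last 3 first.
- by move=> v; rewrite /= in_itv/= andbT lee_fin => /ltW; exact: variance_kernel_ge0.
- by apply/measurable_EFinP; exact: measurable_variance_kernel.
- by rewrite mulr_ge0// ltW// gauss_mass_gt0.
apply: eq_integral => v; rewrite inE/= in_itv/= andbT => v0.
under eq_integral do rewrite /integrand EFinM.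
rewrite ge0_integralZl_EFin//; last 2 first.
- apply/measurable_EFinP; apply: measurableT_comp => //.
  apply: measurable_funM => //; apply: measurableT_comp => //.
  by apply: measurable_funM => //; exact: measurable_quad.
- by apply: mulr_ge0 => //; exact/variance_kernel_ge0/ltW.
have := vintegral_gauss_scaled m Q_posdef k0 v0; rewrite vintegralT => ->.
rewrite -!EFinM; congr EFin.
have sv0 : Num.sqrt v ^+ r != 0 by rewrite expf_neq0// gt_eqF// sqrtr_gt0.
rewrite /variance_kernel exprD invfM.
move: (Num.sqrt v ^+ r) (_ ^- _) v^-1 (expR _) (gauss_mass _ _) sv0 => a b d e f a0.
by field.
Qed.

(** Half of the exponent of the Gaussian kernel pays for the tail while the
    other half stays integrable; mixing over the variance turns the tail factor
    into an increase of the scale [s], hence a decrease of the mass. *)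
Lemma student_kernel_tail c s k rho th : 0 <= c -> rho <= k * quad Q (th - m) ->
  (student_kernel c s k th <= student_kernel c (s + rho / 2) (k / 2) th)%E.
Proof.
move=> c0 rhoq.
have mI (s' k' : R) : measurable_fun (`]0%R, +oo[%classic : set R)
    (fun v : R => (integrand c s' k' th v)%:E).
  apply/measurable_EFinP; apply: measurable_funM.
    by apply: measurable_funM => //; exact: measurable_variance_kernel.
  apply: measurableT_comp => //; apply: measurable_funM => //.
  apply: measurableT_comp => //; apply: measurable_funM => //.
  by apply: measurable_funM => //; apply: measurable_funTS; exact: measurable_invr.
apply: ge0_le_integral => //.
- by move=> v v0; exact: integrand_ge0.
- exact: mI.
- exact: mI.
move=> v; rewrite /= in_itv/= andbT => v0; rewrite lee_fin /variance_kernel.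
rewrite -!mulrA -!expRD; do 2 ? apply: ler_wpM2l; rewrite ?invr_ge0 ?exprn_ge0 ?(ltW v0)//.
apply: ler_wpM2l; rewrite ?invr_ge0 ?(ltW v0)// ler_expR.
move: (quad _ _) rhoq => q rhoq.
have -> : - (s * v^-1) * 2^-1 + - (k * (v^-1 * q)) * 2^-1 =
   - ((s + rho * 2^-1) * v^-1) * 2^-1 + - (k * (2^-1 * (v^-1 * q))) * 2^-1
   - (k * q - rho) * (v^-1 * 4^-1) by field; rewrite gt_eqF.
by rewrite gerDl oppr_le0 mulr_ge0 ?subr_ge0// mulr_ge0// invr_ge0 ltW.
Qed.

Lemma student_tail_mass c s k rho (A : set 'cV[R]_r) : 0 <= c -> 0 < k ->
  measurable [set t : r.-tuple mR | A (cvec t)] ->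
  (forall th, A th -> rho <= k * quad Q (th - m)) ->
  (vintegral A (student_kernel c s k) <=
   (Num.sqrt 2 ^+ r * (c * gauss_mass Q k))%:E * variance_mass N (s + rho / 2))%E.
Proof.
move=> c0 k0 mA Arho.
have k20 : 0 < k / 2 by rewrite divr_gt0.
apply: (@le_trans _ _ (vintegral A (student_kernel c (s + rho / 2) (k / 2)))).
  apply: ge0_le_integral => //.
  - by move=> t _; exact: student_kernel_ge0.
  - by apply: measurable_funTS; exact: measurable_student_kernel.
  - by apply: measurable_funTS; exact: measurable_student_kernel.
  - by move=> t At; apply: student_kernel_tail => //; exact: Arho.
apply: (@le_trans _ _ (vintegral setT (student_kernel c (s + rho / 2) (k / 2)))).
  apply: ge0_subset_integral => //.
  - exact: measurableT.
  - exact: measurable_student_kernel.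
  - by move=> t _; exact: student_kernel_ge0.
by rewrite student_total_mass// gauss_mass_half// mulrCA.
Qed.

End student_kernel.

(** * The posterior kernel of the linear model *)

Section posterior.
Context (R : realType) (n r1 r2 : nat).
Context (Xt : 'M[R]_(n, r1)) (Xg : 'M[R]_(n, r2)) (Sigma : 'M[R]_n).
Hypothesis n_gt : (r1 + r2 < n)%N.
Hypothesis Sigma_posdef : posdef Sigma.
Hypothesis X_full_rank : \rank (row_mx Xt Xg) = (r1 + r2)%N.
Hypothesis X_orth : Xt^T *m invmx Sigma *m Xg = 0.

Local Notation mR := (measurableTypeR R).
Local Notation leb := (@lebesgue_measure R).
Local Notation Si := (invmx Sigma).
Local Notation Q := (Xt^T *m invmx Sigma *m Xt).
Local Notation G := (Xg^T *m invmx Sigma *m Xg).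

Let Si_posdef : posdef Si. Proof. exact: posdef_invmx. Qed.

Lemma theta_gram_posdef : posdef Q.
Proof.
apply: posdef_gram => // z Xz.
have := full_col_rank_inj X_full_rank (z := col_mx z 0).
rewrite mul_row_col Xz mulmx0 addr0 => /(_ erefl) /(congr1 usubmx).
by rewrite col_mxKu => ->; apply/colP => i; rewrite !mxE.
Qed.

Lemma gamma_gram_posdef : posdef G.
Proof.
apply: posdef_gram => // z Xz.
have := full_col_rank_inj X_full_rank (z := col_mx 0 z).
rewrite mul_row_col Xz mulmx0 addr0 => /(_ erefl) /(congr1 dsubmx).
by rewrite col_mxKd => ->; apply/colP => i; rewrite !mxE.
Qed.

Lemma gls_normal_equations r (X : 'M[R]_(n, r)) y :
  posdef (X^T *m Si *m X) -> X^T *m Si *m (X *m gls Sigma X y) = X^T *m Si *m y.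
Proof.
by move=> Xp; rewrite /gls mulmxA !mulmxA mulmxV ?mul1mx// posdef_unit.
Qed.

(** Pythagoras in the metric of [Sigma^-1]: the normal equations make the residual
    orthogonal to both column spaces, which are orthogonal to each other. *)
Lemma residual_decomposition y th ga :
  quad Si (y - (Xt *m th + Xg *m ga)) =
  s2 Xt Xg Sigma y + quad Q (th - theta_hat Xt Sigma y)
                   + quad G (ga - gamma_hat Xg Sigma y).
Proof.
have Xo' : Xg^T *m Si *m Xt = 0.
  have -> : Xg^T *m Si *m Xt = (Xt^T *m Si *m Xg)^T.
    by rewrite !trmx_mul trmxK (proj1 Si_posdef) mulmxA.
  by rewrite X_orth trmx0.
have et := gls_normal_equations y theta_gram_posdef.
have eg := gls_normal_equations y gamma_gram_posdef.
rewrite -/(theta_hat Xt Sigma y) in et; rewrite -/(gamma_hat Xg Sigma y) in eg.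
rewrite /s2.
set h := theta_hat _ _ _ in et *; set k := gamma_hat _ _ _ in eg *.
set e := y - Xt *m h - Xg *m k.
have et0 : Xt^T *m Si *m e = 0.
  by rewrite /e !mulmxBr et subrr mulmxA X_orth mul0mx subrr.
have eg0 : Xg^T *m Si *m e = 0.
  by rewrite /e !mulmxBr eg mulmxA Xo' mul0mx subr0 subrr.
have -> : y - (Xt *m th + Xg *m ga) = Xt *m (h - th) + (Xg *m (k - ga) + e).
  rewrite /e !mulmxBr.
  move: (Xt *m th) (Xt *m h) (Xg *m ga) (Xg *m k) => a b c d.
  by apply/colP => i; rewrite !mxE; ring.
rewrite quadD ?(proj1 Si_posdef)// (quadD _ e) ?(proj1 Si_posdef)// !quad_mulmx.
have -> : ((Xt *m (h - th))^T *m Si *m (Xg *m (k - ga) + e)) = 0.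
  rewrite trmx_mul -!(mulmxA (h - th)^T) mulmxDr mulmxA X_orth mul0mx et0.
  by rewrite addr0 mulmx0.
have -> : ((Xg *m (k - ga))^T *m Si *m e) = 0.
  by rewrite trmx_mul -!(mulmxA (k - ga)^T) eg0 mulmx0.
by rewrite mxE !mulr0 !addr0 -(opprB th) -(opprB ga) !quadN; ring.
Qed.

(** The scale of the posterior: the residual sum of squares, inflated by the
    conflict between the estimate and the prior centre. *)
Definition post_scale (g : R) (y : 'cV[R]_n) : R :=
  s2 Xt Xg Sigma y + (g + 1)^-1 * quad Q (theta_hat Xt Sigma y).

Definition post_center (g : R) (y : 'cV[R]_n) : 'cV[R]_r1 :=
  (g / (g + 1)) *: theta_hat Xt Sigma y.

(** What does not depend on [y], [th] and the variance once the nuisance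
    parameters are integrated out. *)
Definition post_const (g : R) : R :=
  gauss_mass G 1 / (Num.sqrt ((2 * pi) ^+ n * \det Sigma) *
                   Num.sqrt ((2 * pi) ^+ r1 * \det (g *: invmx Q))).

Lemma post_const_gt0 g : 0 < g -> 0 < post_const g.
Proof.
move=> g0; apply: divr_gt0.
  by apply: gauss_mass_gt0 => //; exact: gamma_gram_posdef.
rewrite mulr_gt0 ?sqrtr_gt0//.
- by rewrite mulr_gt0 ?posdef_det_gt0// exprn_gt0// mulr_gt0// pi_gt0.
- rewrite mulr_gt0 ?posdef_det_gt0//; last first.
    by apply: posdefZ => //; apply: posdef_invmx; exact: theta_gram_posdef.
  by rewrite exprn_gt0// mulr_gt0// pi_gt0.
Qed.

Lemma post_integrandE g y th ga v : 0 < g -> 0 < v ->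
  likelihood Xt Xg Sigma y th ga v * gprior Xt Sigma g v th * v^-1 =
  (Num.sqrt ((2 * pi) ^+ n * \det Sigma) *
     Num.sqrt ((2 * pi) ^+ r1 * \det (g *: invmx Q)))^-1 *
  variance_kernel (n + r1) (post_scale g y) v *
  expR (- ((g + 1) / g / v * quad Q (th - post_center g y)) / 2) *
  expR (- (1 / v * quad G (ga - gamma_hat Xg Sigma y)) / 2).
Proof.
move=> g0 v0; rewrite /likelihood /gprior (mulrC g) -scalerA.
have gQp : posdef (g *: invmx Q).
  by apply: posdefZ => //; apply: posdef_invmx; exact: theta_gram_posdef.
rewrite !mvnormal_pdf_scaled// residual_decomposition subr0.
rewrite invmxZ; last by rewrite posdef_unit.
rewrite invmxK quad_scale /variance_kernel exprD.
have Qs : Q^T = Q by case: theta_gram_posdef.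
have E : - (v^-1 * (s2 Xt Xg Sigma y + quad Q (th - theta_hat Xt Sigma y) +
                    quad G (ga - gamma_hat Xg Sigma y))) / 2 +
         - (v^-1 * (g^-1 * quad Q th)) / 2 =
    - (post_scale g y / v) / 2 +
    - ((g + 1) / g / v * quad Q (th - post_center g y)) / 2 +
    - (1 / v * quad G (ga - gamma_hat Xg Sigma y)) / 2.
  have := quad_shrink th (theta_hat Xt Sigma y) Qs g0.
  rewrite /post_scale /post_center.
  set a := quad Q (th - _ *: _); set b := quad Q (theta_hat _ _ _).
  set c := quad Q th; set d := quad Q (th - _).
  move=> /(canRL (addrK _)) ->.
  by field; rewrite !gt_eqF// addr_gt0.
rewrite mulrACA -mulrA [X in _ = X](_ : _ =
  ((Num.sqrt ((2 * pi) ^+ n * \det Sigma) *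
     Num.sqrt ((2 * pi) ^+ r1 * \det (g *: invmx Q)))^-1 *
   ((Num.sqrt v ^+ n * Num.sqrt v ^+ r1)^-1 * v^-1)) *
   expR (- (v^-1 * (s2 Xt Xg Sigma y + quad Q (th - theta_hat Xt Sigma y) +
                    quad G (ga - gamma_hat Xg Sigma y))) / 2 +
         - (v^-1 * (g^-1 * quad Q th)) / 2)).
  rewrite -expRD !invfM; ring.
by rewrite E !expRD; ring.
Qed.

(** Integrating out the [r2] nuisance parameters gains [sqrt v ^+ r2], so the
    inverse-gamma weight keeps the degree [n - r2 + r1]: the marginal posterior
    is a Student distribution with [n - r2] degrees of freedom. *)
Lemma post_kernelE g y th : 0 < g ->
  post_kernel Xt Xg Sigma g y th =
  student_kernel (n - r2) Q (post_center g y) (post_const g) (post_scale g y)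
    ((g + 1) / g) th.
Proof.
move=> g0; apply: eq_integral => v; rewrite inE/= in_itv/= andbT => v0.
have sv0 : Num.sqrt v != 0 by rewrite gt_eqF// sqrtr_gt0.
have nr : (n + r1 = n - r2 + r1 + r2)%N.
  by rewrite addnAC subnK// ltnW// (leq_ltn_trans _ n_gt)// leq_addl.
under [X in vintegral _ X]funext => ga do rewrite post_integrandE// EFinM.
rewrite vintegralT ge0_integralZl_EFin//; last 2 first.
- apply/measurable_EFinP; apply: measurableT_comp => //.
  apply: measurable_funM => //; apply: measurableT_comp => //.
  by apply: measurable_funM => //; exact: measurable_quad.
- apply: mulr_ge0; last exact: expR_ge0.
  apply: mulr_ge0; last by apply: variance_kernel_ge0; exact: ltW.
  by rewrite invr_ge0 mulr_ge0 ?sqrtr_ge0.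
have := vintegral_gauss_scaled (gamma_hat Xg Sigma y) gamma_gram_posdef ltr01 v0.
rewrite vintegralT => ->.
rewrite -EFinM; congr EFin.
rewrite /post_const /variance_kernel {1}nr exprD.
rewrite [X in X = _]mulrAC; congr (_ * _); rewrite (invfM (_ ^+ (n - r2 + r1))).
have : Num.sqrt v ^+ r2 != 0 by rewrite expf_neq0.
move: (Num.sqrt v ^+ r2) (_ ^- _) (_ * _)^-1 v^-1 (expR _) => a b c d e a0.
by field.
Qed.

End posterior.

(** * Bounds on the Bayes factor from prior and posterior probabilities *)

Section odds.
Context (R : realType).

(** In both lemmas [p] is a prior and [q] a posterior probability of the null
    hypothesis, so the expression is the Bayes factor against it. The values
    [q = 0] below and [q = 1] in the next lemma make it infinite and zero. *)
Lemma odds_ratio_ge (c e p q : R) : 0 < c -> c <= p -> p <= 1 - c ->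
  0 < e -> e <= 1 -> 0 <= q -> q <= e ->
  ((c * (e^-1 - 1))%:E <= (p%:E^-1 - 1)^-1 * (q%:E^-1 - 1))%E.
Proof.
move=> c0 cp pc e0 e1 q0 qe; have p0 : 0 < p by rewrite (lt_le_trans c0).
have p1 : p < 1 by rewrite (le_lt_trans pc)// gtrBl.
have op : 0 < p^-1 - 1 by rewrite subr_gt0 invf_gt1.
have cop : c <= (p^-1 - 1)^-1.
  have -> : (p^-1 - 1)^-1 = p / (1 - p) by field; rewrite !gt_eqF ?subr_gt0.
  by rewrite ler_pdivlMr ?subr_gt0//; nra.
rewrite (inver p) gt_eqF// -EFinB inver gt_eqF//.
have [->|qn0] := eqVneq q 0.
  by rewrite inve0 addye// gt0_muley ?leey// lte_fin invr_gt0.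
rewrite inver (negPf qn0) -EFinB -EFinM lee_fin ler_pM ?(ltW c0)//.
  by rewrite subr_ge0 invf_ge1.
by rewrite lerD2r lef_pV2 ?posrE// lt_neqAle eq_sym qn0.
Qed.

Lemma odds_ratio_inv_ge (c e p q : R) : 0 < c -> c <= p -> p <= 1 - c ->
  0 < e -> e < 1 -> 1 - e <= q -> q <= 1 ->
  ((c * (e^-1 - 1))%:E <= ((p%:E^-1 - 1)^-1 * (q%:E^-1 - 1))^-1)%E.
Proof.
move=> c0 cp pc e0 e1 eq q1; have p0 : 0 < p by rewrite (lt_le_trans c0).
have p1 : p < 1 by rewrite (le_lt_trans pc)// gtrBl.
have op : 0 < p^-1 - 1 by rewrite subr_gt0 invf_gt1.
have q0 : 0 < q by rewrite (lt_le_trans _ eq)// subr_gt0.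
rewrite (inver p) gt_eqF// -EFinB inver gt_eqF// inver gt_eqF// -EFinB -EFinM.
rewrite inver; case: eqVneq => [_|n0]; first exact: leey.
have qn1 : q < 1.
  rewrite lt_neqAle q1 andbT; apply: contraNneq n0 => ->.
  by rewrite invr1 subrr mulr0.
rewrite lee_fin invfM invrK.
have -> : (q^-1 - 1)^-1 = q / (1 - q) by field; rewrite !gt_eqF ?subr_gt0.
have -> : e^-1 - 1 = (1 - e) / e by field; rewrite gt_eqF.
rewrite ler_pM ?(ltW c0) ?divr_ge0 ?subr_ge0 ?(ltW e0) ?(ltW e1)//.
  have -> : p^-1 - 1 = (1 - p) / p by field; rewrite gt_eqF.
  rewrite ler_pdivlMr//; nra.
rewrite ler_pM ?subr_ge0 ?invr_ge0 ?(ltW e0) ?(ltW e1)//.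
by rewrite lef_pV2 ?posrE ?subr_gt0// lerBlDr addrC -lerBlDr.
Qed.

End odds.

(** * Prior probabilities bounded away from zero and one *)

Section boxes.
Context (R : realType).
Local Notation mR := (measurableTypeR R).
Local Notation leb := (@lebesgue_measure R).

(** On tuples, which carry the measure, so that the volume can be computed by
    induction on the number of coordinates. *)
Definition box n (I : set R) : set (n.-tuple mR) := [set t | forall i, I (tnth t i)].
Arguments box : clear implicits.

Lemma measurable_box n (I : set R) : measurable (I : set mR) -> measurable (box n I).
Proof.
move=> mI; rewrite (_ : box n I =
    \bigcap_(i in [set: 'I_n]) ((fun t : n.-tuple mR => tnth t i) @^-1` I)).
  apply: fin_bigcap_measurable => // i _.
  by rewrite -[X in measurable X]setTI; exact: measurable_tnth.
by apply/seteqP; split => t /= H i; [move=> _|]; exact: H.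
Qed.

Lemma lebesgue_tuple_box n (I : set R) (l : R) :
  measurable (I : set mR) -> leb I = l%:E ->
  @lebesgue_tuple R n (box n I) = (l ^+ n)%:E.
Proof.
move=> mI lI; elim: n => [|n IHn].
  by rewrite /= diracE expr0 mem_set// => -[].
rewrite /= /cons_measure /pushforward.
rewrite (_ : _ @^-1` _ = I `*` box n I).
  rewrite product_measure1E//; last exact: measurable_box.
  by rewrite exprS EFinM; congr (_ * _)%E.
apply/seteqP; split => -[x t] /=.
  move=> H; split; first by have := H ord0; rewrite (tnth_nth x).
  by move=> i; have := H (lift ord0 i); rewrite !(tnth_nth x).
move=> [Ix It] i; case: (unliftP ord0 i) => [j ->|->].
  by have := It j; rewrite !(tnth_nth x).
by rewrite (tnth_nth x).
Qed.

Lemma measurable_nonpos n :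
  measurable [set t : n.-tuple mR | [set th : 'cV[R]_n | nonpos th] (cvec t)].
Proof.
rewrite (_ : [set _ | _] = box n `]-oo, 0%R]%classic); first exact: measurable_box.
apply/seteqP; split => t /=.
  by move=> /forallP H i; have := H i; rewrite mxE /= in_itv.
by move=> H; apply/forallP => i; have := H i; rewrite /= in_itv mxE.
Qed.

End boxes.
Arguments box {R} n I _.

Section prior.
Context (R : realType) (n r : nat) (X : 'M[R]_(n, r)) (Sigma : 'M[R]_n).
Local Notation Q := (X^T *m invmx Sigma *m X).
Local Notation mR := (measurableTypeR R).
Local Notation leb := (@lebesgue_measure R).
Hypothesis Q_posdef : posdef Q.

Let c0 := (Num.sqrt ((2 * pi) ^+ r * \det (invmx Q)))^-1.

Let c0_gt0 : 0 < c0.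
Proof.
rewrite invr_gt0 sqrtr_gt0 mulr_gt0 ?exprn_gt0 ?mulr_gt0 ?pi_gt0//.
by apply: posdef_det_gt0; exact: posdef_invmx.
Qed.

Lemma gpriorE g th : 0 < g -> gprior X Sigma g 1 th =
  c0 * (Num.sqrt g ^+ r)^-1 * expR (- (1 / g * quad Q (th - 0)) / 2).
Proof.
move=> g0; rewrite /gprior mulr1 mvnormal_pdf_scaled//; last exact: posdef_invmx.
by rewrite invmxK invfM mul1r.
Qed.

Let gprior_ge0 g th : 0 < g -> (0 <= (gprior X Sigma g 1 th)%:E)%E.
Proof.
move=> g0; rewrite lee_fin gpriorE// mulr_ge0 ?expR_ge0// mulr_ge0 ?(ltW c0_gt0)//.
Qed.

Let measurable_gprior g : 0 < g ->
  measurable_fun [set: r.-tuple mR] (fun t => (gprior X Sigma g 1 (cvec t))%:E).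
Proof.
move=> g0; apply/measurable_EFinP; under eq_fun do rewrite gpriorE//.
apply: measurable_funM => //; apply: measurableT_comp => //.
apply: measurable_funM => //; apply: measurableT_comp => //.
by apply: measurable_funM => //; exact: measurable_quad.
Qed.

Lemma prior_prob_setT g : 0 < g -> prior_prob X Sigma g setT = 1%E.
Proof.
move=> g0; rewrite /prior_prob vintegralT.
under eq_integral do rewrite gpriorE// EFinM.
have c0' : 0 <= c0 * (Num.sqrt g ^+ r)^-1.
  by rewrite mulr_ge0 ?(ltW c0_gt0)// invr_ge0 exprn_ge0// sqrtr_ge0.
rewrite ge0_integralZl_EFin//; last first.
  apply/measurable_EFinP; apply: measurableT_comp => //.
  apply: measurable_funM => //; apply: measurableT_comp => //.
  by apply: measurable_funM => //; exact: measurable_quad.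
have := vintegral_gauss_scaled 0 Q_posdef ltr01 g0; rewrite vintegralT => ->.
rewrite -EFinM mulrCA -mulrA mulVf ?mulr1; last first.
  by rewrite expf_neq0// gt_eqF// sqrtr_gt0.
congr EFin; rewrite /gauss_mass expr1n mul1r /c0 det_inv divff// gt_eqF//.
by move: c0_gt0; rewrite /c0 invr_gt0 det_inv.
Qed.

(** Scaling a box by [sqrt g] multiplies its volume by what the normalising
    constant of the prior loses, so its prior mass is bounded below uniformly
    in [g]. *)
Lemma prior_prob_box_ge g (A : set 'cV[R]_r) (I : set R) : 0 < g ->
  measurable [set t : r.-tuple mR | A (cvec t)] -> measurable (I : set mR) ->
  leb I = (Num.sqrt g)%:E -> (forall x, I x -> `|x| <= Num.sqrt g) ->
  (forall t : r.-tuple mR, box r I t -> A (cvec t)) ->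
  ((c0 * expR (- (\sum_j \sum_i `|Q i j|) / 2))%:E <= prior_prob X Sigma g A)%E.
Proof.
move=> g0 mA mI lI Ig IA.
set S := \sum_j _; have sg : Num.sqrt g ^+ r != 0.
  by rewrite expf_neq0// gt_eqF// sqrtr_gt0.
pose c := c0 * (Num.sqrt g ^+ r)^-1 * expR (- S / 2).
have -> : (c0 * expR (- S / 2))%:E = (c%:E * @lebesgue_tuple R r (box r I))%E.
  by rewrite (lebesgue_tuple_box _ mI lI) -EFinM /c; congr EFin; field.
apply: ge0_integral_ge_cst => //.
- exact: measurable_box.
- by rewrite /c !mulr_ge0 ?expR_ge0 ?(ltW c0_gt0)// invr_ge0 exprn_ge0// sqrtr_ge0.
- by apply: measurable_funTS; exact: measurable_gprior.
- by move=> t _; exact: gprior_ge0.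
move=> t It; rewrite lee_fin gpriorE// /c; apply: ler_wpM2l.
  by rewrite !mulr_ge0 ?(ltW c0_gt0)// invr_ge0 exprn_ge0// sqrtr_ge0.
rewrite ler_expR ler_wpM2r// lerN2 subr0 mul1r mulrC ler_pdivrMr//.
rewrite [leRHS]mulrC -(sqr_sqrtr (ltW g0)); apply: quad_box_le => i.
by rewrite mxE; exact/Ig/It.
Qed.

(** The orthant and its complement each contain a box of side [sqrt g]; that the
    positive box avoids the orthant uses one coordinate, hence [0 < r]. *)
Lemma prior_prob_nonpos_bounds : (0 < r)%N ->
  exists2 c : R, 0 < c & forall g, 0 < g -> exists p,
    [/\ prior_prob X Sigma g [set th | nonpos th] = p%:E, c <= p & p <= 1 - c].
Proof.
move=> r0; pose c := c0 * expR (- (\sum_j \sum_i `|Q i j|) / 2).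
exists c => [|g g0]; first by rewrite mulr_gt0 ?expR_gt0.
have sg0 : 0 < Num.sqrt g by rewrite sqrtr_gt0.
set A := [set th | nonpos th].
have mA : measurable [set t : r.-tuple mR | A (cvec t)] by exact: measurable_nonpos.
have mAC : measurable [set t : r.-tuple mR | (~` A) (cvec t)].
  exact: measurableC.
have geA : (c%:E <= prior_prob X Sigma g A)%E.
  apply: (@prior_prob_box_ge g A `[- Num.sqrt g, 0%R]%classic) => //.
  - rewrite lebesgue_measure_itv/= lte_fin oppr_lt0 sg0.
    by rewrite -EFinD add0r opprK.
  - by move=> x; rewrite /= in_itv/= => /andP[x1 x2]; rewrite ler0_norm// lerNl.
  - move=> t It; apply/forallP => i; have := It i.
    by rewrite /= in_itv/= mxE => /andP[].
have geAC : (c%:E <= prior_prob X Sigma g (~` A))%E.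
  apply: (@prior_prob_box_ge g (~` A) `]0%R, Num.sqrt g]%classic) => //.
  - by rewrite lebesgue_measure_itv/= lte_fin sg0 -EFinD subr0.
  - by move=> x; rewrite /= in_itv/= => /andP[x1 x2]; rewrite ger0_norm// ltW.
  - move=> t It /forallP /(_ (Ordinal r0)); have := It (Ordinal r0).
    by rewrite /= in_itv/= mxE => /andP[x0 _]; rewrite leNgt x0.
have sumA : (prior_prob X Sigma g A + prior_prob X Sigma g (~` A) = 1)%E.
  rewrite -(prior_prob_setT g0) /prior_prob /vintegral -ge0_integral_setU//.
  - congr (integral _ _ _); apply/seteqP; split => t //= _.
    exact: lem.
  - by apply: measurable_funTS; exact: measurable_gprior.
  - by move=> t _; exact: gprior_ge0.
  - by apply/disj_setPS => t /= [].
move: geA geAC sumA; case: (prior_prob _ _ g A) => [p| |] //; last first.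
  by case: (prior_prob _ _ g _) => [q| |].
case: (prior_prob _ _ g _) => [q| |] //.
rewrite !lee_fin -EFinD => cp cq [pq]; exists p; split => //.
by rewrite lerBrDr -pq lerD2l.
Qed.

End prior.

(** * Posterior concentration and divergence of the Bayes factor *)

Section concentration.
Context (R : realType) (n r1 r2 : nat).
Context (Xt : 'M[R]_(n, r1)) (Xg : 'M[R]_(n, r2)) (Sigma : 'M[R]_n).
Hypotheses (n_gt : (r1 + r2 < n)%N) (r1_gt0 : (0 < r1)%N).
Hypothesis Sigma_posdef : posdef Sigma.
Hypothesis X_full_rank : \rank (row_mx Xt Xg) = (r1 + r2)%N.
Hypothesis X_orth : Xt^T *m invmx Sigma *m Xg = 0.

Local Notation mR := (measurableTypeR R).
Local Notation Q := (Xt^T *m invmx Sigma *m Xt).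
Local Notation that := (theta_hat Xt Sigma).
Local Notation kern := (post_kernel Xt Xg Sigma).
Local Notation ctr := (post_center Xt Sigma).

Let Q_posdef : posdef Q.
Proof. exact: (theta_gram_posdef Sigma_posdef X_full_rank). Qed.

Let kernE g y : 0 < g -> kern g y =
  student_kernel (n - r2) Q (ctr g y) (post_const Xt Xg Sigma g)
    (post_scale Xt Xg Sigma g y) ((g + 1) / g).
Proof.
by move=> g0; apply/funext => th; exact: (post_kernelE n_gt).
Qed.

Let post_const_ge0 g : 0 < g -> 0 <= post_const Xt Xg Sigma g.
Proof. by move=> g0; apply/ltW/post_const_gt0. Qed.

(** As long as [g] is at least of the order of the squared length of the
    estimate, the posterior scale stays within one unit of the residual sum of
    squares, so tails measured from the centre are small uniformly in the data. *)
Lemma post_concentration (sig e : R) : 0 < sig -> 0 < e ->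
  exists2 rho : R, 0 <= rho & forall g y (A : set 'cV[R]_r1), 0 < g ->
    s2 Xt Xg Sigma y = sig -> quad Q (that y) <= g + 1 ->
    measurable [set t : r1.-tuple mR | A (cvec t)] ->
    (forall th, A th -> rho <= quad Q (th - ctr g y)) ->
    exists T a : R, [/\ vintegral setT (kern g y) = T%:E,
      vintegral A (kern g y) = a%:E, 0 < T, 0 <= a & a <= e * T].
Proof.
move=> sig0 e0; set N := (n - r2)%N.
have N2 : (2 <= N)%N by rewrite ltn_subRL (leq_ltn_trans _ n_gt)// addnC leq_add2r.
have [C HC] := variance_mass_le N2 sig0.
have fin s : sig <= s -> exists2 w : R, variance_mass N s = w%:E & 0 < w.
  move=> ss; have := HC _ ss; have := variance_mass_gt0 N s.
  by case: (variance_mass N s) => [w| |]//; rewrite lte_fin => w0 _; exists w.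
have [|w1 W1 w10] := fin (sig + 1); first by rewrite lerDl.
(* The cost of halving the precision of the Gaussian kernel in the tail bound. *)
pose K := Num.sqrt 2 ^+ r1 : R.
have K0 : 0 < K by rewrite exprn_gt0// sqrtr_gt0.
pose C' := `|C| + 1.
have C'0 : 0 < C' by rewrite ltr_wpDl.
(* Chosen so that K * variance_mass N (s + rho / 2), at most K * C' / (rho / 2),
   is at most e * variance_mass N (sig + 1). *)
pose rho := 2 * (K * C' / (e * w1)).
have rho0 : 0 < rho by rewrite mulr_gt0// divr_gt0// mulr_gt0.
exists rho => [|g y A g0 sy qg mA Arho]; first exact: ltW.
have g10 : 0 < g + 1 by rewrite addr_gt0.
have k0 : 0 < (g + 1) / g by rewrite divr_gt0.
have k1 : 1 <= (g + 1) / g by rewrite ler_pdivlMr// mul1r lerDl.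
have c0 := post_const_ge0 g0.
rewrite kernE//; set s := post_scale _ _ _ g y.
have [s1 s2] : sig <= s /\ s <= sig + 1.
  rewrite /s /post_scale sy lerDl lerD2l; split.
    by rewrite mulr_ge0 ?invr_ge0 ?(ltW g10)// posdef_quad_ge0.
  by rewrite mulrC ler_pdivrMr// mul1r.
pose f := post_const Xt Xg Sigma g * gauss_mass Q ((g + 1) / g).
have f0 : 0 < f.
  by rewrite mulr_gt0 ?gauss_mass_gt0//; exact: post_const_gt0.
have [w W w0] := fin _ s1.
have [|v V v0] := fin (s + rho / 2); first by rewrite (le_trans s1)// lerDl divr_ge0// ltW.
have w1w : w1 <= w.
  by rewrite -lee_fin -W1 -W; exact: variance_mass_nonincreasing.
have vle : v * K <= e * w1.
  have : v <= C / (s + rho / 2).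
    by rewrite -lee_fin -V; apply: HC; rewrite (le_trans s1)// lerDl divr_ge0// ltW.
  rewrite -ler_pdivlMr// => /le_trans; apply.
  have -> : e * w1 / K = C' / (rho / 2).
    by rewrite /rho; field; rewrite !gt_eqF.
  have r20 : 0 < rho / 2 by rewrite divr_gt0.
  have s0 : 0 < s by rewrite (lt_le_trans sig0).
  rewrite ler_pdivrMr; last exact: addr_gt0.
  rewrite mulrDr divfK ?gt_eqF//.
  rewrite (@le_trans _ _ C')//; first by rewrite (le_trans (ler_norm C))// lerDl.
  by rewrite lerDr; apply: mulr_ge0; [apply: divr_ge0|]; exact: ltW.
have mass_ge0 : (0 <= vintegral A (student_kernel N Q (ctr g y)
    (post_const Xt Xg Sigma g) s ((g + 1) / g)))%E.
  by apply: integral_ge0 => t _; exact: student_kernel_ge0.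
have mass_le : (vintegral A (student_kernel N Q (ctr g y)
    (post_const Xt Xg Sigma g) s ((g + 1) / g)) <= (K * f * v)%:E)%E.
  rewrite EFinM -V; apply: student_tail_mass => // th Ath.
  rewrite (le_trans (Arho _ Ath))// ler_peMl// posdef_quad_ge0//.
exists (f * w).
move: mass_ge0 mass_le; case: (vintegral A _) => [a| |]//.
rewrite !lee_fin => a0 aK; exists a; split => //.
- by rewrite student_total_mass// W.
- by rewrite mulr_gt0.
apply: (le_trans aK); rewrite (_ : K * f * v = f * (v * K)); last by ring.
rewrite [leRHS]mulrCA ler_wpM2l ?(ltW f0)// (le_trans vle)// ler_wpM2l//.
exact: ltW.
Qed.

Let mA0 : measurable [set t : r1.-tuple mR | [set th : 'cV[R]_r1 | nonpos th] (cvec t)].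
Proof. exact: measurable_nonpos. Qed.

Let mAC0 :
  measurable [set t : r1.-tuple mR | (~` [set th : 'cV[R]_r1 | nonpos th]) (cvec t)].
Proof. exact: measurableC. Qed.

Let post_mass_setC g y : 0 < g ->
  (vintegral [set th | nonpos th] (kern g y) +
   vintegral (~` [set th | nonpos th]) (kern g y) = vintegral setT (kern g y))%E.
Proof.
move=> g0; rewrite kernE// /vintegral -ge0_integral_setU//.
- congr (integral _ _ _); apply/seteqP; split => t //= _; exact: lem.
- by apply: measurable_funTS; apply: measurable_student_kernel; exact: post_const_ge0.
- by move=> t _; apply: student_kernel_ge0; exact: post_const_ge0.
- by apply/disj_setPS => t /= [].
Qed.

(** The value of [g] that serves as a witness below the supremum: large enough for
    the prior not to inflate the posterior scale, and at least one so that the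
    posterior centre keeps half of the estimate. *)
Let gdata y := quad Q (that y) + 1.

Let gdata_ge1 y : 1 <= gdata y.
Proof. by rewrite lerDr posdef_quad_ge0. Qed.

Let gdata_gt0 y : 0 < gdata y.
Proof. by rewrite (lt_le_trans ltr01). Qed.

Let gdata_quad y : quad Q (that y) <= gdata y + 1.
Proof. by rewrite /gdata -addrA lerDl addr_ge0. Qed.

(** If one coordinate of [th] has the sign opposite to that of a large coordinate
    of the estimate, then [th] differs in it from the posterior centre by at least
    half of the size of the latter. *)
Let ctr_far y (th : 'cV[R]_r1) (i : 'I_r1) (rho L : R) : 0 <= rho -> 0 <= L ->
  2 * (1 + invmx Q i i * rho) <= L ->
  (L <= that y i ord0 /\ th i ord0 <= 0) \/ (that y i ord0 <= - L /\ 0 <= th i ord0) ->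
  rho <= quad Q (th - ctr (gdata y) y).
Proof.
move=> rho0 L0 qL far; have q0 := posdef_diag_gt0 i (posdef_invmx Q_posdef).
have := coord_sqr_le_quad i (th - ctr (gdata y) y) Q_posdef.
rewrite /post_center [in X in X -> _]mxE [in X in X -> _]mxE [in X in X -> _]mxE.
set q := invmx Q i i in q0 qL *; set u := th i ord0 in far *.
set h := that y i ord0 in far *; move: (quad _ _) => W.
move: (gdata y) (gdata_ge1 y) => g g1 HW.
have gg : 1 / 2 <= g / (g + 1).
  by rewrite ler_pdivlMr ?addr_gt0 ?(lt_le_trans ltr01 g1)//; lra.
rewrite -(ler_pM2l q0); apply: le_trans HW.
have : 0 <= q * rho by rewrite mulr_ge0// ltW.
move: (q * rho) qL => x qL x0.
move: (g / (g + 1)) gg => c gg.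
apply: (@le_trans _ _ ((1 + x) ^+ 2)).
  by nra.
rewrite -[leRHS]real_normK ?num_real// lerXn2r ?nnegrE ?addr_ge0//.
case: far => -[h1 h2].
  by rewrite ler_normr opprB; apply/orP; right; nra.
by rewrite ler_normr; apply/orP; left; nra.
Qed.

Let prior_bounds : exists2 c : R, 0 < c & forall g, 0 < g -> exists p,
  [/\ prior_prob Xt Sigma g [set th | nonpos th] = p%:E, c <= p & p <= 1 - c].
Proof. exact: prior_prob_nonpos_bounds. Qed.

(** The posterior probability at which the odds against it, weakened by the prior
    odds bound [c], are worth [`|M| + 1]. *)
Let level (c M : R) := c / (`|M| + 1 + c).

Let levelP c M : 0 < c ->
  [/\ 0 < level c M, level c M < 1 & M <= c * ((level c M)^-1 - 1)].
Proof.
move=> c0; have M0 : 0 < `|M| + 1 + c by rewrite addr_gt0// ltr_wpDl.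
rewrite /level; split; first exact: divr_gt0.
  by rewrite ltr_pdivrMr// mul1r ltrDr ltr_wpDl.
rewrite invf_div (_ : c * _ = `|M| + 1); last by field; rewrite gt_eqF.
by rewrite (le_trans (ler_norm M))// lerDl.
Qed.

(** A sum over all coordinates, so that one threshold works for each of them. *)
Let radius (rho : R) := \sum_j 2 * (1 + invmx Q j j * rho).

Let radius_ge (i : 'I_r1) rho : 0 <= rho -> 2 * (1 + invmx Q i i * rho) <= radius rho.
Proof.
move=> rho0; rewrite /radius (bigD1 i)//= lerDl sumr_ge0// => j _.
rewrite mulr_ge0// addr_ge0// mulr_ge0//.
by apply/ltW/posdef_diag_gt0/posdef_invmx.
Qed.

Let radius_ge0 rho : 0 <= rho -> 0 <= radius rho.
Proof.
move=> rho0; rewrite /radius sumr_ge0// => j _.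
rewrite mulr_ge0// addr_ge0// mulr_ge0//.
by apply/ltW/posdef_diag_gt0/posdef_invmx.
Qed.

Lemma B10_fixed_large (sig M : R) : 0 < sig -> exists L : R, forall y i,
  s2 Xt Xg Sigma y = sig -> L <= that y i ord0 ->
  exists2 g, 0 < g & (M%:E <= B10_fixed Xt Xg Sigma g y)%E.
Proof.
move=> sig0; have [c c0 Hc] := prior_bounds.
have [e0 e1 eM] := levelP M c0; set e := level c M in e0 e1 eM.
have [rho rho0 H] := post_concentration sig0 e0.
exists (radius rho) => y i sy Li; exists (gdata y); first exact: gdata_gt0.
have [|T [a [HT Ha T0 a0 aT]]] :=
    H _ y [set th | nonpos th] (gdata_gt0 y) sy (gdata_quad y) mA0.
  move=> th /forallP /(_ i) thi.
  apply: (@ctr_far y th i rho (radius rho)) => //.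
  - exact: radius_ge0.
  - exact: radius_ge.
  - by left.
have [p [Hp cp pc]] := Hc _ (gdata_gt0 y).
apply: (@le_trans _ _ (c * (e^-1 - 1))%:E); first by rewrite lee_fin.
rewrite /B10_fixed Hp /post_prob HT Ha (inver T) gt_eqF// -EFinM.
apply: odds_ratio_ge => //; first exact: ltW.
- by rewrite divr_ge0// ltW.
- by rewrite ler_pdivrMr.
Qed.

Lemma B01_fixed_large (sig M : R) : 0 < sig -> exists L : R, forall y,
  s2 Xt Xg Sigma y = sig -> (forall i, that y i ord0 <= - L) ->
  exists2 g, 0 < g & (M%:E <= B01_fixed Xt Xg Sigma g y)%E.
Proof.
move=> sig0; have [c c0 Hc] := prior_bounds.
have [e0 e1 eM] := levelP M c0; set e := level c M in e0 e1 eM.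
have [rho rho0 H] := post_concentration sig0 e0.
exists (radius rho) => y sy Li; exists (gdata y); first exact: gdata_gt0.
have [|T [a [HT Ha T0 a0 aT]]] :=
    H _ y (~` [set th | nonpos th]) (gdata_gt0 y) sy (gdata_quad y) mAC0.
  move=> th /negP; rewrite /nonpos negb_forall => /existsP[i].
  rewrite -ltNge => /ltW thi.
  apply: (@ctr_far y th i rho (radius rho)) => //.
  - exact: radius_ge0.
  - exact: radius_ge.
  - by right.
have [p [Hp cp pc]] := Hc _ (gdata_gt0 y).
apply: (@le_trans _ _ (c * (e^-1 - 1))%:E); first by rewrite lee_fin.
rewrite /B01_fixed /B10_fixed Hp /post_prob HT.
have := post_mass_setC y (gdata_gt0 y); rewrite HT Ha.
case: (vintegral _ _) => [x| |]//; rewrite -EFinD => -[xa].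
rewrite (inver T) gt_eqF// -EFinM.
apply: odds_ratio_inv_ge => //.
- by rewrite ler_pdivlMr// -xa; nra.
- by rewrite ler_pdivrMr// -xa mul1r lerDl.
Qed.

End concentration.

Theorem lemma9 (R : realType) (n r1 r2 : nat)
    (Xt : 'M[R]_(n, r1)) (Xg : 'M[R]_(n, r2)) (Sigma : 'M[R]_n)
    (r1_gt0 : (0 < r1)%N) (n_gt : (r1 + r2 < n)%N)
    (Sigma_posdef : posdef Sigma)
    (X_full_rank : \rank (row_mx Xt Xg) = (r1 + r2)%N)
    (X_orth : Xt^T *m invmx Sigma *m Xg = 0) :
  information_consistent Xt Xg Sigma (B10_gmax Xt Xg Sigma).
Proof.
move=> c s y s_gt0 _ ys; split => [_ [i /cvgryPge yi]|yi].
- apply/cvgeyPge => M.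
  have [L HL] := B10_fixed_large n_gt r1_gt0 Sigma_posdef X_full_rank X_orth M s_gt0.
  near=> k.
  have Lk : L <= theta_hat Xt Sigma (y k) i ord0 by near: k; exact: yi.
  have pk : 1 <= theta_hat Xt Sigma (y k) i ord0 by near: k; exact: yi.
  rewrite /B10_gmax ifF; last first.
    by apply/negbTE/forallPn; exists i; rewrite -ltNge (lt_le_trans ltr01).
  have [g g0 Mg] := HL _ _ (ys k) Lk.
  by apply: (le_trans Mg); apply: ereal_sup_ubound; exists g.
- (* Here the estimate is eventually nonpositive and the Bayes factor is the
     inverse of a supremum, so large values of B01_fixed make it small. *)
  have small (d : R) : 0 < d -> \forall k \near \oo,
      (0 <= B10_gmax Xt Xg Sigma (y k) <= d%:E)%E.
    move=> d0.
    have [L HL] := B01_fixed_large n_gt r1_gt0 Sigma_posdef X_full_rank X_orth d^-1 s_gt0.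
    have yiL K : \forall k \near \oo, forall i, theta_hat Xt Sigma (y k) i ord0 <= K.
      by apply: filter_forall => i; move/cvgrNyPle : (yi i); exact.
    near=> k.
    have Lk : forall i, theta_hat Xt Sigma (y k) i ord0 <= - L by near: k; exact: yiL.
    have pk : forall i, theta_hat Xt Sigma (y k) i ord0 <= 0 by near: k; exact: yiL.
    rewrite /B10_gmax ifT; last exact/forallP.
    have [g g0 Mg] := HL _ (ys k) Lk.
    have supd : (d^-1%:E <= ereal_sup
        [set B01_fixed Xt Xg Sigma g (y k) | g in [set g : R | 0 < g]%R])%E.
      by apply: (le_trans Mg); apply: ereal_sup_ubound; exists g.
    have sup0 : (0 <= ereal_sup
        [set B01_fixed Xt Xg Sigma g (y k) | g in [set g : R | 0 < g]%R])%E.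
      by rewrite (le_trans _ supd)// lee_fin invr_ge0 ltW.
    rewrite inve_ge0 sup0/=.
    rewrite inve_ple ?inE//; last by rewrite lee_fin ltW.
    by rewrite inver gt_eqF.
  apply/fine_cvgP; split.
    have := small 1 ltr01; apply: filterS => k /andP[B0 B1].
    by rewrite ge0_fin_numE// (le_lt_trans B1)// ltry.
  apply/cvgrPdist_le => d d0; have := small d d0; apply: filterS => k /andP[B0 B1].
  have Bfin : B10_gmax Xt Xg Sigma (y k) \is a fin_num.
    by rewrite ge0_fin_numE// (le_lt_trans B1)// ltry.
  by rewrite sub0r normrN /= ger0_norm ?fine_ge0// -lee_fin fineK.
Unshelve. all: by end_near. Qed.
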